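(* Let $\mathcal{A}$ be a C*-algebra and $a\in\mathcal{A}^+$. For every continuous hermitian linear functional $f$ on $\mathcal{A}$, $$\|a^{1/2}fa^{1/2}\|=\inf\{f_1(a)+f_2(a):f=f_1-f_2,\ f_1,f_2\in\mathcal{A}^{*+}\}.$$
   Context: $\mathcal{A}^{*+}$ is the set of positive continuous linear functionals on $\mathcal{A}$. For $f\in\mathcal{A}^*$, $a^{1/2}fa^{1/2}$ is the functional $x\mapsto f(a^{1/2}xa^{1/2})$, and $\|\cdot\|$ is the norm of $\mathcal{A}^*$. *)

(* Defs.v *)
From HB Require Import structures.
From mathcomp Require Import all_boot all_order all_algebra.
From mathcomp Require Import complex.
From mathcomp Require Import boolp classical_sets reals.
From Stdlib Require Import ClassicalEpsilon.
Set Implicit Arguments. Unset Strict Implicit. Unset Printing Implicit Defensive.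
Import Order.TTheory GRing.Theory Num.Theory.
Local Open Scope ring_scope.
Local Open Scope classical_set_scope.

Record is_Cstar_algebra (R : realType) (A : lmodType R[i])
    (mul : A -> A -> A) (star : A -> A) (norm : A -> R) : Prop := {
  cs_mulA : forall x y z, mul x (mul y z) = mul (mul x y) z;
  cs_mulDl : forall x y z, mul (x + y) z = mul x z + mul y z;
  cs_mulDr : forall x y z, mul x (y + z) = mul x y + mul x z;
  cs_mulZl : forall (c : R[i]) x y, mul (c *: x) y = c *: mul x y;
  cs_mulZr : forall (c : R[i]) x y, mul x (c *: y) = c *: mul x y;
  cs_norm_eq0 : forall x, norm x = 0 -> x = 0;
  cs_normD : forall x y, norm (x + y) <= norm x + norm y;
  cs_normZ : forall (c : R[i]) x, norm (c *: x) = ComplexField.Normc.normc c * norm x;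
  cs_normM : forall x y, norm (mul x y) <= norm x * norm y;
  cs_complete : forall u : nat -> A,
      (forall e : R, 0 < e -> exists N, forall m n, (N <= m)%N -> (N <= n)%N ->
           norm (u m - u n) < e) ->
      exists l, forall e : R, 0 < e -> exists N, forall n, (N <= n)%N ->
           norm (u n - l) < e;
  cs_starK : forall x, star (star x) = x;
  cs_starD : forall x y, star (x + y) = star x + star y;
  cs_starZ : forall (c : R[i]) x, star (c *: x) = (conjc c) *: star x;
  cs_starM : forall x y, star (mul x y) = mul (star y) (star x);
  cs_Cstar : forall x, norm (mul (star x) x) = norm x ^+ 2
}.

Section CstarDefs.
Variables (R : realType) (A : lmodType R[i])
  (mul : A -> A -> A) (star : A -> A) (norm : A -> R).

(** Quasi-invertibility (invertibility of 1 - x in the unitization). *)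
Definition quasi_invertible (x : A) : Prop :=
  exists y, x + y - mul x y = 0 /\ y + x - mul y x = 0.

(** Spectrum of x (in the unitization when A is non-unital; 0 is always
    included, which is harmless for positivity):
    lambda \in sp(x) iff lambda = 0 or x/lambda is not quasi-invertible,
    i.e. lambda - x is not invertible in the unitization. *)
Definition spectrum (x : A) : set R[i] :=
  [set l | l = 0 \/ ~ quasi_invertible (l^-1 *: x)].

Definition Cstar_pos (a : A) : Prop :=
  star a = a /\ forall l, spectrum a l -> 0 <= l.

Definition Cstar_sqrt (a : A) : A :=
  epsilon (inhabits 0) (fun b => Cstar_pos b /\ mul b b = a).

Definition lin_functional (f : A -> R[i]) : Prop :=
  (forall x y, f (x + y) = f x + f y) /\ (forall (c : R[i]) x, f (c *: x) = c * f x).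

Definition cont_functional (f : A -> R[i]) : Prop :=
  lin_functional f /\ exists M : R, forall x, ComplexField.Normc.normc (f x) <= M * norm x.

Definition hermitian_functional (f : A -> R[i]) : Prop :=
  cont_functional f /\ forall x, f (star x) = conjc (f x).

Definition pos_functional (f : A -> R[i]) : Prop :=
  cont_functional f /\ forall a, Cstar_pos a -> 0 <= f a.

Definition dual_norm (f : A -> R[i]) : R :=
  sup [set r : R | exists x, norm x <= 1 /\ r = ComplexField.Normc.normc (f x)].

Definition sandwich (a : A) (f : A -> R[i]) : A -> R[i] :=
  fun x => f (mul (Cstar_sqrt a) (mul x (Cstar_sqrt a))).

End CstarDefs.

(* Main.v *)
(** The theorem is a duality statement, proved with an elementary approach to
positivity in a unital C*-algebra: a self-adjoint [h] is positive when
[norm (s - h) <= s] for some [s]. This visibly defines a cone, it provides square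
roots by iteration, and it amounts to nonnegative spectrum without any use of the
spectral radius formula. The non-unital case is reduced to it by adjoining a unit.

Write [b] for the square root of [a] and [N] for the norm of [b f b].
If [f = f1 - f2] and [y] is a self-adjoint contraction, then [- a <= b y b <= a],
so [f (b y b) <= f1 a + f2 a]; since [f] is hermitian this bounds [N].
Conversely, for [e > 0] the element [d = (b + e)^2] of the unitization is an order
unit, and any [x] in [A] with [- d <= x <= d] is [(b + e) y (b + e)] for a
contraction [y], so that [f x <= N + O(e)]. This makes the functional
[y |-> inf {t c - f v | t >= 0, v >= 0, y + v <= t d}], with [2 c = N + f a + O(e)],
a well defined sublinear one, and Hahn-Banach gives a linear [f1] below it. Then
[f1 >= 0], [f1 >= f] and [f1 a <= c], so that [f1 - (f1 - f)] is a decomposition of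
[f] with [f1 a + (f1 - f) a <= 2 c - f a = N + O(e)]. *)

From Stdlib Require Import Ncring Ncring_tac.
Require Import Defs.
From HB Require Import structures.
From mathcomp Require Import all_boot all_order all_algebra.
From mathcomp Require Import ring lra complex.
From mathcomp Require Import boolp classical_sets reals.
Set Implicit Arguments. Unset Strict Implicit. Unset Printing Implicit Defensive.
Import Order.TTheory GRing.Theory Num.Theory.
Local Open Scope ring_scope.
Local Open Scope classical_set_scope.

Local Notation normc := ComplexField.Normc.normc.

(** * Normalisation of identities in noncommutative rings *)

Section NoncommutativeRing.
Variable U : nzRingType.

#[local] Instance nzRing_ops :
  @Ring_ops U 0 1 +%R *%R (fun x y => x - y) -%R eq := {}.

#[local] Instance nzRing_Ncring : Ring (Ro := nzRing_ops).
Proof.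
split; try exact: eq_equivalence; rewrite /equality /eq_notation
  /addition /add_notation /multiplication /mul_notation /zero /zero_notation
  /one /one_notation /subtraction /sub_notation /opposite /opp_notation /=.
- by move=> x _ <- y _ <-.
- by move=> x _ <- y _ <-.
- by move=> x _ <- y _ <-.
- by move=> x _ <-.
- exact: add0r.
- exact: addrC.
- exact: addrA.
- exact: mul1r.
- exact: mulr1.
- exact: mulrA.
- exact: mulrDl.
- by move=> x y z; exact: mulrDr.
- by [].
- exact: subrr.
Qed.
End NoncommutativeRing.
#[local] Existing Instance nzRing_ops.
#[local] Existing Instance nzRing_Ncring.

Ltac ncring := non_commutative_ring.

(** * Modulus of complex numbers *)

Section ComplexModulus.
Variable R : realType.
Implicit Types (r : R) (c : R[i]).

Lemma normc_ge0 c : 0 <= normc c.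
Proof. by case: c => x y; exact: sqrtr_ge0. Qed.

Lemma normc_real r : normc r%:C%C = `|r|.
Proof. by rewrite /= expr0n addr0 sqrtr_sqr. Qed.

Lemma normc_conj c : normc (conjc c) = normc c.
Proof. by case: c => x y /=; rewrite sqrrN. Qed.

Lemma normc_i : normc ('i%C : R[i]) = 1.
Proof. by rewrite /= expr0n add0r expr1n sqrtr1. Qed.

Lemma normc_N c : normc (- c) = normc c.
Proof. by case: c => x y /=; rewrite !sqrrN. Qed.

Lemma mulii : 'i%C * 'i%C = -1 :> R[i].
Proof. by rewrite -expr2 sqr_i. Qed.

Lemma normc_le (c : R[i]) : normc c <= `|complex.Re c| + `|complex.Im c|.
Proof.
case: c => x y /=; rewrite -[leRHS]ger0_norm ?addr_ge0 // -sqrtr_sqr.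
rewrite ler_wsqrtr // -[x ^+ 2]real_normK ?num_real // -[y ^+ 2]real_normK ?num_real //.
by have := normr_ge0 x; have := normr_ge0 y; nra.
Qed.

Lemma ler_norm_Re_normc (c : R[i]) : `|complex.Re c| <= normc c.
Proof. by case: c => x y /=; rewrite -sqrtr_sqr ler_wsqrtr // lerDl sqr_ge0. Qed.

Lemma ler_norm_Im_normc (c : R[i]) : `|complex.Im c| <= normc c.
Proof. by case: c => x y /=; rewrite -sqrtr_sqr ler_wsqrtr // lerDr sqr_ge0. Qed.

Lemma normc_triangle (x y : R[i]) : normc (x + y) <= normc x + normc y.
Proof.
have E (z : R[i]) : `|z| = (normc z)%:C%C by case: z => p q; rewrite normc_def.
by rewrite -lecR rmorphD -!E; exact: ler_normD.
Qed.

Lemma ler_Re_normc c : complex.Re c <= normc c.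
Proof. exact: le_trans (ler_norm _) (ler_norm_Re_normc c). Qed.

End ComplexModulus.

(** * Norm, involution and limits in a C*-algebra *)

Section CstarNorm.
Variables (R : realType) (A : lmodType R[i])
  (mul : A -> A -> A) (star : A -> A) (norm : A -> R).
Hypothesis HA : is_Cstar_algebra mul star norm.

Lemma cs_norm0 : norm 0 = 0.
Proof. by rewrite -(scale0r (0 : A)) (cs_normZ HA) normc_real normr0 mul0r. Qed.

Lemma cs_normN x : norm (- x) = norm x.
Proof. by rewrite -scaleN1r (cs_normZ HA) normc_N ComplexField.Normc.normc1 mul1r. Qed.

Lemma cs_norm_ge0 x : 0 <= norm x.
Proof. by have := cs_normD HA x (- x); rewrite subrr cs_norm0 cs_normN; lra. Qed.

Lemma cs_normB x y : norm (x - y) <= norm x + norm y.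
Proof. by rewrite -(cs_normN y); exact: cs_normD HA _ _. Qed.

Lemma cs_norm_distC x y : norm (x - y) = norm (y - x).
Proof. by rewrite -cs_normN opprB. Qed.

Lemma cs_norm_split x y z : norm (x - z) <= norm (x - y) + norm (y - z).
Proof. by rewrite -[x - z](subrKA y); exact: cs_normD HA _ _. Qed.

(** The C*-identity and submultiplicativity bound [norm y ^+ 2] by [norm (star y) * norm y];
    dividing by [norm y] gives one inequality, and the involution gives the other. *)
Lemma cs_norm_star x : norm (star x) = norm x.
Proof.
have H y : norm y <= norm (star y).
  have [->|y0] := eqVneq (norm y) 0; first exact: cs_norm_ge0.
  have ylt : 0 < norm y by rewrite lt_def y0 cs_norm_ge0.
  by rewrite -(ler_pM2r ylt) -expr2 -(cs_Cstar HA) (cs_normM HA).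
by apply/eqP; rewrite eq_le H -{2}(cs_starK HA x) H.
Qed.

Lemma cs_star0 : star 0 = 0.
Proof. by rewrite -{1}(scale0r (0 : A)) (cs_starZ HA) conjc0 scale0r. Qed.

Lemma cs_starN x : star (- x) = - star x.
Proof. by rewrite -[- x]scaleN1r -[RHS]scaleN1r (cs_starZ HA) rmorphN1. Qed.

Lemma cs_starB x y : star (x - y) = star x - star y.
Proof. by rewrite (cs_starD HA) cs_starN. Qed.

Lemma cs_norm_realZ (r : R) x : norm (r%:C%C *: x) = `|r| * norm x.
Proof. by rewrite (cs_normZ HA) normc_real. Qed.

(** This is how identities pass to the limit: both sides are approximated up to a fixed multiple of
    an arbitrary [e]. *)
Lemma cs_eq_small K x y :
  (forall e : R, 0 < e -> norm (x - y) <= K * e) -> x = y.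
Proof.
move=> H; apply/eqP; rewrite -subr_eq0; apply/eqP; apply: (cs_norm_eq0 HA).
apply/eqP; rewrite eq_le cs_norm_ge0 andbT leNgt; apply/negP => n0.
have K0 : 0 <= K by have := H 1 ltr01; have := cs_norm_ge0 (x - y); lra.
(* With this [e] the norm equals [2 * (K + 1) * e], which exceeds [K * e]. *)
have e0 : 0 < norm (x - y) / (K + 1) / 2.
  by rewrite !divr_gt0 //; lra.
have := H _ e0; set e := norm _ / _ / 2.
have -> : norm (x - y) = (K + 1) * e * 2 by rewrite /e; field; lra.
by rewrite -/e in e0; nra.
Qed.

(** By telescoping, the increments of [u] between any two indices are at most those of [r]. The
    sequence [r] is nondecreasing and bounded, so an index where it is [e]-close to its supremum
    controls the whole tail of [u]. *)
Lemma cs_cvg_dominated (u : nat -> A) (r : nat -> R) (B : R) :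
    (forall n, norm (u n.+1 - u n) <= r n.+1 - r n) -> (forall n, r n <= B) ->
  exists l, forall e, 0 < e -> exists n, forall m, (n <= m)%N -> norm (u m - l) < e.
Proof.
move=> du rB; apply: (cs_complete HA) => e e0.
have dur n k : norm (u (n + k)%N - u n) <= r (n + k)%N - r n.
  elim: k => [|k IH]; first by rewrite addn0 !subrr cs_norm0.
  by rewrite addnS; have := cs_norm_split (u (n + k).+1) (u (n + k)%N) (u n);
     have := du (n + k)%N; lra.
have hs : has_sup (range r).
  by split; [exists (r 0%N), 0%N|exists B => _ [n _ <-]].
have [_ [n _ <-] rn] := sup_adherent e0 hs.
have rs m : r m <= sup (range r) by apply: ub_le_sup hs.2 _ _; exists m.
have rm k m : (k <= m)%N -> r k <= r m.
  by move=> /subnKC <-; have := dur k (m - k)%N; have := cs_norm_ge0 (u (k + (m - k))%N - u k); lra.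
have key k m : (n <= k)%N -> (k <= m)%N -> norm (u m - u k) < e.
  move=> nk /subnKC km; have := dur k (m - k)%N; rewrite km.
  by have := rs m; have := rm _ _ nk; lra.
exists n => m k nm nk; case: (leqP m k) => mk; last exact: key (ltnW mk).
by rewrite cs_norm_distC; exact: key.
Qed.

End CstarNorm.

(** * Neumann series and square roots in a unital C*-algebra *)

Section UnitalCstar.
Variables (R : realType) (U : algType R[i]) (star : U -> U) (norm : U -> R).
Hypothesis HU : is_Cstar_algebra *%R star norm.
Implicit Types (r s t : R) (x y z h k b c d : U).

(** Real scalars are made elements of the ring, so that [ncring] can handle them; their centrality
    is supplied separately by [rscalC]. *)
Definition rscal r : U := r%:C%C%:A.

Lemma rscalD r s : rscal (r + s) = rscal r + rscal s.
Proof. by rewrite /rscal rmorphD scalerDl. Qed.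
Lemma rscalN r : rscal (- r) = - rscal r.
Proof. by rewrite /rscal rmorphN scaleNr. Qed.
Lemma rscalB r s : rscal (r - s) = rscal r - rscal s.
Proof. by rewrite rscalD rscalN. Qed.
Lemma rscal0 : rscal 0 = 0.
Proof. exact: scale0r. Qed.
Lemma rscal1 : rscal 1 = 1.
Proof. exact: scale1r. Qed.
Lemma rscalE r x : rscal r * x = r%:C%C *: x.
Proof. by rewrite /rscal mulr_algl. Qed.
Lemma rscalC r x : x * rscal r = rscal r * x.
Proof. by rewrite rscalE /rscal mulr_algr. Qed.
Lemma rscalM r s : rscal (r * s) = rscal r * rscal s.
Proof. by rewrite rscalE /rscal scalerA rmorphM. Qed.
Lemma rscal_sqr r : rscal (r ^+ 2) = rscal r * rscal r.
Proof. by rewrite -rscalM expr2. Qed.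

Lemma star1 : star 1 = 1.
Proof. by have := cs_starM HU (star 1) 1; rewrite mulr1 (cs_starK HU) mulr1. Qed.
Lemma star_rscal r : star (rscal r) = rscal r.
Proof. by rewrite /rscal (cs_starZ HU) star1 conjc_real. Qed.

Lemma norm_1 : norm 1 = 1.
Proof.
have := cs_Cstar HU 1; rewrite star1 mulr1 => /eqP.
rewrite expr2 -subr_eq0 -{1}[norm 1]mulr1 -mulrBr mulf_eq0 => /orP[/eqP/(cs_norm_eq0 HU)/eqP|].
  by rewrite oner_eq0.
by rewrite subr_eq0 => /eqP.
Qed.

Lemma norm_rscalM r x : norm (rscal r * x) = `|r| * norm x.
Proof. by rewrite rscalE (cs_norm_realZ HU). Qed.
Lemma norm_rscal r : norm (rscal r) = `|r|.
Proof. by rewrite -[rscal r]mulr1 norm_rscalM norm_1 mulr1. Qed.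

Definition invertible x := exists y, x * y = 1 /\ y * x = 1.

Lemma invertibleM x y : invertible x -> invertible y -> invertible (x * y).
Proof.
move=> [x' [xx' x'x]] [y' [yy' y'y]]; exists (y' * x').
by rewrite -!mulrA (mulrA y) yy' mul1r xx' (mulrA x') x'x mul1r y'y.
Qed.

Lemma invertible_rscal r : r != 0 -> invertible (rscal r).
Proof.
by move=> r0; exists (rscal r^-1); rewrite -!rscalM mulfV // mulVf // rscal1.
Qed.

Lemma invertible_1B x : norm x < 1 -> invertible (1 - x).
Proof.
move=> x1; pose q := norm x; have q0 : 0 <= q := cs_norm_ge0 HU x.
(* [u n] is the partial sum [1 + x + ... + x^(n-1)] of the Neumann series, dominated by the partial
   sum [r n] of the geometric series of ratio [q]. *)
pose u := fix u n := if n is m.+1 then 1 + x * u m else 0.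
pose r n := (1 - q ^+ n) / (1 - q).
have du n : norm (u n.+1 - u n) <= r n.+1 - r n.
  have -> : r n.+1 - r n = q ^+ n by rewrite /r exprS; field; rewrite /q; lra.
  elim: n => [|n IH]; first by rewrite /= mulr0 addr0 subr0 norm_1 expr0.
  have -> : u n.+2 - u n.+1 = x * (u n.+1 - u n) by rewrite /=; ncring.
  rewrite (le_trans (cs_normM HU _ _)) // exprS.
  by rewrite -/q ler_wpM2l.
have rB n : r n <= (1 - q)^-1.
  by rewrite /r ler_piMl ?invr_ge0 ?subr_ge0 ?lerBlDr ?lerDl ?exprn_ge0 // ltW.
have [l ul] := cs_cvg_dominated HU du rB.
have ux n : x * u n = u n * x.
  elim: n => [|n IH]; first by rewrite /= mul0r mulr0.
  by rewrite /= mulrDl mulrDr -mulrA -IH mul1r mulr1.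
have un n : (1 - x) * u n - 1 = - (u n.+1 - u n) by rewrite /=; ncring.
have un' n : u n * (1 - x) - 1 = - (u n.+1 - u n).
  by rewrite -un mulrBl mulrBr ux mul1r mulr1.
have small e : 0 < e -> exists n, norm (u n.+1 - u n) <= 2 * e /\ norm (u n - l) <= e.
  move=> e0; have [n un0] := ul _ e0; exists n.
  have := un0 n (leqnn n); have := un0 n.+1 (leqnSn n).
  have := cs_norm_split HU (u n.+1) l (u n).
  by rewrite (cs_norm_distC HU l); lra.
exists l; split; apply: (cs_eq_small HU (K := 2 + norm (1 - x))) => e e0;
  have [n [d1 d2]] := small e e0.
- have -> : (1 - x) * l - 1 = ((1 - x) * u n - 1) - (1 - x) * (u n - l) by ncring.
  rewrite un; apply: (le_trans (cs_normB HU _ _)); rewrite (cs_normN HU).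
  apply: (le_trans (lerD d1 (cs_normM HU _ _))).
  by rewrite [leRHS]mulrDl lerD2l ler_wpM2l // (cs_norm_ge0 HU).
- have -> : l * (1 - x) - 1 = (u n * (1 - x) - 1) - (u n - l) * (1 - x) by ncring.
  rewrite un'; apply: (le_trans (cs_normB HU _ _)); rewrite (cs_normN HU).
  apply: (le_trans (lerD d1 (cs_normM HU _ _))).
  by rewrite [leRHS]mulrDl lerD2l mulrC ler_wpM2l // (cs_norm_ge0 HU).
Qed.

(* The iteration [w' = (z + w^2) / 2]: its increments are dominated by those of
   the scalar iteration [r' = (1 + r^2) / 2], which increases and stays below 1. *)
Lemma binomial_root z : norm z <= 1 -> exists w,
  [/\ w + w = z + w * w, norm w <= 1, star z = z -> star w = w
    & forall x, x * z = z * x -> x * w = w * x].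
Proof.
move=> z1; pose u := fix u n := if n is m.+1 then rscal (2^-1) * (z + u m * u m) else 0.
pose r := fix r n : R := if n is m.+1 then 2^-1 * (1 + r m * r m) else 0.
have uS n : u n.+1 = rscal 2^-1 * (z + u n * u n) by [].
have rS n : r n.+1 = 2^-1 * (1 + r n * r n) by [].
have rb n : 0 <= r n <= 1.
  elim: n => [|n /andP[r0 r1]] /=; first by rewrite lexx ler01.
  by apply/andP; split; nra.
have ur n : norm (u n) <= r n.
  elim: n => [|n IH] /=; first by rewrite (cs_norm0 HU).
  rewrite norm_rscalM gtr0_norm ?invr_gt0 // ler_pM2l ?invr_gt0 //.
  apply: (le_trans (cs_normD HU _ _)); apply: lerD => //.
  apply: (le_trans (cs_normM HU _ _)).
  by rewrite ler_pM // (cs_norm_ge0 HU).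
have sqB x y : norm (x * x - y * y) <= (norm x + norm y) * norm (x - y).
  have -> : x * x - y * y = x * (x - y) + (x - y) * y by ncring.
  apply: (le_trans (cs_normD HU _ _)); rewrite [leRHS]mulrDl.
  apply: lerD; first exact: cs_normM HU _ _.
  by rewrite mulrC; exact: cs_normM HU _ _.
have du n : norm (u n.+1 - u n) <= r n.+1 - r n.
  elim: n => [|n IH]; first by rewrite subr0 (le_trans (ur 1%N)) // subr0.
  have -> : u n.+2 - u n.+1 = rscal 2^-1 * (u n.+1 * u n.+1 - u n * u n).
    by rewrite (uS n.+1) [X in _ - X = _]uS; ncring.
  have -> : r n.+2 - r n.+1 = 2^-1 * ((r n.+1 + r n) * (r n.+1 - r n)).
    by rewrite (rS n.+1) [X in _ - X = _]rS; ring.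
  rewrite norm_rscalM gtr0_norm ?invr_gt0 // ler_pM2l ?invr_gt0 //.
  apply: (le_trans (sqB _ _)).
  by rewrite ler_pM ?addr_ge0 ?(cs_norm_ge0 HU) ?lerD.
have rB n : r n <= 1 by have /andP[] := rb n.
have [w uw] := cs_cvg_dominated HU du rB.
have u1 n : norm (u n) <= 1 by apply: le_trans (ur n) (rB n).
have w1 : norm w <= 1.
  apply/ler_addgt0Pr => e e0; have [n un] := uw _ e0.
  have := un n (leqnn n); have := u1 n; have := cs_normB HU (u n) (u n - w).
  by rewrite subKr; lra.
exists w; split=> //.
- apply: (cs_eq_small HU (K := 4)) => e e0; have [n un] := uw _ e0.
  have un1 : u n.+1 + u n.+1 = z + u n * u n.
    by rewrite -mulrDl -rscalD (_ : 2^-1 + 2^-1 = 1 :> R) ?rscal1 ?mul1r //; field.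
  have -> : w + w - (z + w * w) = (u n * u n - w * w)
      - ((u n.+1 - w) + (u n.+1 - w)) + (u n.+1 + u n.+1 - (z + u n * u n)) by ncring.
  rewrite un1 subrr addr0.
  apply: (le_trans (cs_normB HU _ _)); have := sqB (u n) w.
  have := cs_normD HU (u n.+1 - w) (u n.+1 - w).
  have := un n (leqnn n); have := un n.+1 (leqnSn n).
  have := u1 n; have := cs_norm_ge0 HU (u n - w).
  by have := cs_norm_ge0 HU (u n); have := cs_norm_ge0 HU w; nra.
- move=> sz; have su n : star (u n) = u n.
    elim: n => [|n IH] /=; first exact: cs_star0 HU.
    by rewrite (cs_starM HU) (cs_starD HU) (cs_starM HU) IH sz star_rscal rscalC.
  apply: (cs_eq_small HU (K := 2)) => e e0; have [n un] := uw _ e0.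
  apply: (le_trans (cs_norm_split HU _ (u n) _)).
  rewrite -{1}(su n) -(cs_starB HU) (cs_norm_star HU) (cs_norm_distC HU w).
  by have := un n (leqnn n); lra.
- move=> x xz; have xu n : x * u n = u n * x.
    elim: n => [|n IH] /=; first by rewrite mulr0 mul0r.
    rewrite -mulrA mulrDl -xz -[u n * u n * x]mulrA -IH (mulrA (u n)) -IH -(mulrA x) -mulrDr.
    by rewrite mulrA rscalC mulrA.
  apply: (cs_eq_small HU (K := 2 * norm x)) => e e0; have [n un] := uw _ e0.
  have -> : x * w - w * x = (u n - w) * x - x * (u n - w) + (x * u n - u n * x) by ncring.
  rewrite xu subrr addr0; apply: (le_trans (cs_normB HU _ _)).
  have := cs_normM HU (u n - w) x; have := cs_normM HU x (u n - w).
  have := un n (leqnn n); have := cs_norm_ge0 HU x.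
  by have := cs_norm_ge0 HU (u n - w); nra.
Qed.

(* For the C*-norm this is equivalent to [h] having nonnegative spectrum
   (see [pos_of_invertible] and [pos_resolvent]), while it is visibly a convex cone. *)
Definition pos h := star h = h /\ exists s, norm (rscal s - h) <= s.

(** Write [h = s (1 - z)] with [norm z <= 1]. The equation [2 w = z + w^2] says that [1 - w] is a
    square root of [1 - z], and [d] is [1 - w] scaled by the root of [s]. It commutes with whatever
    commutes with [h] because [w] does so with respect to [z]. *)
Lemma pos_sqrt h : pos h -> exists d,
  [/\ pos d, d * d = h & forall x, x * h = h * x -> x * d = d * x].
Proof.
(* The given radius may be 0; adding 1 makes it invertible and keeps the inequality. *)
move=> [sh [s' hs']]; pose s := s' + 1.
have s'0 : 0 <= s' by apply: le_trans hs'; exact: cs_norm_ge0 HU _.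
have s0 : 0 < s by rewrite /s; lra.
have hs : norm (rscal s - h) <= s.
  rewrite /s rscalD rscal1 addrAC; apply: (le_trans (cs_normD HU _ _)).
  by rewrite norm_1 lerD2r.
pose z := 1 - rscal s^-1 * h.
have zE : rscal s * z = rscal s - h.
  by rewrite /z mulrBr mulr1 mulrA -rscalM mulfV ?gt_eqF // rscal1 mul1r.
have z1 : norm z <= 1.
  have : norm (rscal s * z) <= s by rewrite zE.
  by rewrite norm_rscalM gtr0_norm // -{2}[s]mulr1 ler_pM2l.
have sz : star z = z.
  by rewrite /z (cs_starB HU) star1 (cs_starM HU) sh star_rscal rscalC.
have [w [wE w1 sw cw]] := binomial_root z1.
pose q := Num.sqrt s; have q0 : 0 <= q by exact: sqrtr_ge0.
have qs : q * q = s by rewrite -expr2 sqr_sqrtr // ltW.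
exists (rscal q * (1 - w)); split.
- split; first by rewrite (cs_starM HU) (cs_starB HU) star1 sw // star_rscal rscalC.
  exists q; rewrite mulrBr mulr1 subKr norm_rscalM ger0_norm //.
  by rewrite ler_piMr.
- have -> : rscal q * (1 - w) * (rscal q * (1 - w)) = rscal s * ((1 - w) * (1 - w)).
    by rewrite -qs rscalM -!mulrA; congr (_ * _); rewrite !mulrA rscalC.
  have -> : (1 - w) * (1 - w) = 1 - z - (w + w - (z + w * w)) by ncring.
  by rewrite wE subrr subr0 mulrBr mulr1 zE subKr.
- move=> x xh; have xz : x * z = z * x.
    by rewrite /z mulrBr mulrBl mulr1 mul1r mulrA rscalC -!mulrA xh.
  by rewrite mulrA rscalC -!mulrA mulrBr mulrBl mulr1 mul1r (cw _ xz).
Qed.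

End UnitalCstar.

(** * The positive cone: order, norm and invertibility *)

Section PositiveCone.
Variables (R : realType) (U : algType R[i]) (star : U -> U) (norm : U -> R).
Hypothesis HU : is_Cstar_algebra *%R star norm.
Implicit Types (r s t : R) (x y z h k b c d : U).
Local Notation rscal := (rscal U).
Local Notation pos := (pos star norm).

Lemma norm_sqr x : star x = x -> norm (x * x) = norm x ^+ 2.
Proof. by move=> sx; rewrite -(cs_Cstar HU) sx. Qed.

(* [u = b + i c] satisfies [u^* u = s], and [c] is the imaginary part of [u]. *)
Lemma norm_sqr_sum_le b c s : 0 <= s -> star b = b -> star c = c ->
  b * c = c * b -> b * b + c * c = rscal s -> norm c ^+ 2 <= s.
Proof.
move=> s0 sb sc bc bcs; pose u := b + 'i%C *: c.
have su : star u = b - 'i%C *: c.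
  rewrite /u (cs_starD HU) (cs_starZ HU) sb sc -scaleNr; congr (_ + _ *: _).
  by apply/eqP; rewrite eq_complex /= oppr0 !eqxx.
have uu : star u * u = rscal s.
  rewrite -bcs su /u mulrBl !mulrDr -!scalerAl -!scalerAr scalerA bc.
  rewrite mulii scaleN1r opprD opprK addrA.
  by rewrite addrK.
have nu : norm u ^+ 2 = s by rewrite -(cs_Cstar HU) uu (norm_rscal HU) ger0_norm.
have uB : u - star u = (2%:C%C * 'i%C) *: c.
  rewrite su /u opprB addrC subrKA -scalerDl; congr (_ *: _).
  by rewrite (_ : 2 = 1 + 1 :> R) // rmorphD rmorph1 mulrDl mul1r.
have : norm (u - star u) <= norm u + norm u.
  by rewrite -{2}(cs_norm_star HU u); exact: cs_normB HU _ _.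
rewrite uB (cs_normZ HU) ComplexField.Normc.normcM normc_real normc_i mulr1 ger0_norm //.
move=> cu; rewrite -nu ler_pXn2r ?nnegrE ?(cs_norm_ge0 HU) //.
by move: cu; lra.
Qed.

(** The element [s - b^2] is positive, with radius [s], so it has a root [c] commuting with [b].
    Then [b^2 + c^2 = s], and the bound on [c] is a bound on [s - b^2]. *)
Lemma norm_rscal_sub_sqr b s : star b = b -> norm b ^+ 2 <= s ->
  norm (rscal s - b * b) <= s.
Proof.
move=> sb bs; have s0 : 0 <= s by apply: le_trans bs; exact: sqr_ge0.
have pc : pos (rscal s - b * b).
  split; first by rewrite (cs_starB HU) (star_rscal HU) (cs_starM HU) sb.
  by exists s; rewrite subKr norm_sqr.
have [c [[sc _] cE cc]] := pos_sqrt HU pc.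
have bc : b * c = c * b.
  by apply: cc; rewrite mulrBr mulrBl rscalC mulrA.
rewrite -cE norm_sqr //; apply: norm_sqr_sum_le bc _ => //.
by rewrite cE addrC subrK.
Qed.

Lemma pos_sqr b : star b = b -> pos (b * b).
Proof.
move=> sb; split; first by rewrite (cs_starM HU) sb.
by exists (norm b ^+ 2); exact: norm_rscal_sub_sqr.
Qed.

(** The existential radius in [pos] can thus be any [s] above the norm: write [h] as a square and
    apply the previous estimate. *)
Lemma pos_norm h s : pos h -> norm h <= s -> norm (rscal s - h) <= s.
Proof.
move=> /(pos_sqrt HU)[d [[sd _] <- _]] ds.
by apply: norm_rscal_sub_sqr => //; rewrite -norm_sqr.
Qed.

Lemma pos_add h k : pos h -> pos k -> pos (h + k).
Proof.
move=> [sh [s hs]] [sk [t kt]]; split; first by rewrite (cs_starD HU) sh sk.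
exists (s + t); rewrite rscalD opprD addrACA.
by apply: (le_trans (cs_normD HU _ _)); exact: lerD.
Qed.

Lemma pos_rscalM r h : 0 <= r -> pos h -> pos (rscal r * h).
Proof.
move=> r0 [sh [s hs]]; split.
  by rewrite (cs_starM HU) sh (star_rscal HU) rscalC.
exists (r * s); rewrite rscalM -mulrBr (norm_rscalM HU) ger0_norm //.
exact: ler_wpM2l.
Qed.

Lemma pos_rscal r : 0 <= r -> pos (rscal r).
Proof.
move=> r0; split; first exact: star_rscal HU _.
by exists r; rewrite subrr (cs_norm0 HU).
Qed.

Lemma pos_0 : pos 0.
Proof. by rewrite -(rscal0 U); exact: pos_rscal. Qed.

Lemma pos_rscalB x s : star x = x -> norm x <= s -> pos (rscal s - x).
Proof.
move=> sx xs; split; first by rewrite (cs_starB HU) sx (star_rscal HU).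
by exists s; rewrite subKr.
Qed.

Lemma pos_rscalD x s : star x = x -> norm x <= s -> pos (rscal s + x).
Proof.
move=> sx xs; rewrite -[x]opprK; apply: pos_rscalB.
  by rewrite (cs_starN HU) sx.
by rewrite (cs_normN HU).
Qed.

(** The roots of [h] and of [s - h] commute and their squares add up to [s], so [norm_sqr_sum_le]
    bounds the root of [h]. *)
Lemma pos_norm_le h s : 0 <= s -> pos h -> pos (rscal s - h) -> norm h <= s.
Proof.
move=> s0 /(pos_sqrt HU)[d [[sd _] dE dc]] /(pos_sqrt HU)[c [[sc _] cE cc]].
have hc : h * c = c * h by apply: cc; rewrite mulrBr mulrBl rscalC.
have cd : c * d = d * c by apply: dc; rewrite hc.
rewrite -dE norm_sqr //; apply: norm_sqr_sum_le s0 sc sd cd _.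
by rewrite cE dE subrK.
Qed.

(** The roots [e] of [s - x] and [d] of [s + x] commute, so [s^2 - x^2] is the square of the
    self-adjoint [d e]. Hence [0 <= x^2 <= s^2] in the order, and [pos_norm_le] applies. *)
Lemma norm_le_pos x s : 0 <= s -> star x = x ->
  pos (rscal s - x) -> pos (rscal s + x) -> norm x <= s.
Proof.
move=> s0 sx /(pos_sqrt HU)[e [[se _] eE ec]] /(pos_sqrt HU)[d [[sd _] dE dc]].
have xe : x * e = e * x by apply: ec; rewrite mulrBr mulrBl rscalC.
have ed : e * d = d * e by apply: dc; rewrite mulrDr mulrDl rscalC xe.
have sde : star (d * e) = d * e by rewrite (cs_starM HU) sd se.
have deE : d * e * (d * e) = rscal (s ^+ 2) - x * x.
  rewrite -mulrA (mulrA e) ed -(mulrA d) eE mulrA dE rscal_sqr.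
  have -> : (rscal s + x) * (rscal s - x) =
    rscal s * rscal s - x * x + (x * rscal s - rscal s * x) by ncring.
  by rewrite (rscalC s x) subrr addr0.
have := pos_norm_le (sqr_ge0 s) (pos_sqr sx).
rewrite -deE => /(_ (pos_sqr sde)).
by rewrite norm_sqr // ler_pXn2r ?nnegrE ?(cs_norm_ge0 HU).
Qed.

(** The radius [norm h + e] is valid for [h + e], and subtracting cancels [e]: the norm of
    [norm h - h] is at most [norm h + e] for every [e]. *)
Lemma pos_closed h : (forall e, 0 < e -> pos (h + rscal e)) -> pos h.
Proof.
move=> H; split.
  have [+ _] := H _ ltr01; rewrite (cs_starD HU) (star_rscal HU).
  exact: addIr.
exists (norm h); apply/ler_addgt0Pr => e e0.
have -> : rscal (norm h) - h = rscal (norm h + e) - (h + rscal e).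
  by rewrite rscalD opprD addrACA subrr addr0.
apply: pos_norm (H e e0) _; apply: (le_trans (cs_normD HU _ _)).
by rewrite (norm_rscal HU) gtr0_norm.
Qed.

Lemma invertible_star_id h y : star h = h -> h * y = 1 -> y * h = 1 -> star y = y.
Proof.
move=> sh hy yh; have : star y * h = 1 by rewrite -{1}sh -(cs_starM HU) hy (star1 HU).
by move=> yh'; rewrite -[star y]mulr1 -hy mulrA yh' mul1r.
Qed.

(* If [t0] is the least [t >= 0] with [h + t] positive and [t0 > 0], then
   [k = h + t0 = b^2] is invertible and [k - d = (b (1 - d k^-1)^(1/2))^2] is
   still positive for small [d]. *)
Lemma pos_of_invertible h : star h = h ->
  (forall e, 0 < e -> invertible (h + rscal e)) -> pos h.
Proof.
move=> sh hinv; pose S := [set t | 0 <= t /\ pos (h + rscal t)].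
have S0 : S !=set0.
  exists (norm h); split; first exact: cs_norm_ge0 HU _.
  by rewrite addrC; exact: pos_rscalD.
have Slb : lbound S 0 by move=> t [].
have hS : has_inf S by split => //; exists 0.
have t0 : 0 <= inf S by exact: lb_le_inf.
have pk : pos (h + rscal (inf S)).
  apply: pos_closed => e e0.
  have [t [t1 pt] te] := inf_adherent e0 hS.
  rewrite -addrA -rscalD (_ : inf S + e = t + (inf S + e - t)); last by ring.
  rewrite rscalD addrA; apply: pos_add pt (pos_rscal _).
  by rewrite subr_ge0 ltW.
move: t0; rewrite le_eqVlt => /orP[/eqP t0|t0]; first by rewrite -t0 rscal0 addr0 in pk.
set k := h + _ in pk; have [y [ky yk]] := hinv _ t0; rewrite -/k in ky yk.
have sy : star y = y by exact: invertible_star_id pk.1 ky yk.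
have [b [[sb _] bE bc]] := pos_sqrt HU pk.
have ny0 := cs_norm_ge0 HU y.
(* The first bound keeps [inf S - dl] nonnegative; the second makes [1 - dl y] positive. *)
pose dl := Num.min (inf S) (norm y + 1)^-1.
have dl0 : 0 < dl by rewrite lt_min t0 invr_gt0; lra.
have dly : dl * norm y <= 1.
  have : dl <= (norm y + 1)^-1 by rewrite ge_min lexx orbT.
  move=> /(ler_wpM2r ny0) /le_trans; apply.
  by rewrite mulrC ler_pdivrMr; lra.
have dlS : dl <= inf S by rewrite ge_min lexx.
have pe : pos (1 - rscal dl * y).
  rewrite -(rscal1 U); apply: pos_rscalB.
    by rewrite (cs_starM HU) sy (star_rscal HU) rscalC.
  by rewrite (norm_rscalM HU) gtr0_norm.
have [e [[se _] eE ec]] := pos_sqrt HU pe.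
have bk : b * k = k * b by rewrite -bE mulrA.
have by_ : b * y = y * b.
  by rewrite -[b * y]mul1r -yk -mulrA (mulrA k) -bk -(mulrA b) ky mulr1.
have be : b * e = e * b.
  by apply: ec; rewrite mulrBr mulrBl mulr1 mul1r mulrA rscalC -!mulrA by_.
have : pos (b * e * (b * e)).
  by apply: pos_sqr; rewrite (cs_starM HU) sb se be.
have -> : b * e * (b * e) = h + rscal (inf S - dl).
  rewrite -mulrA (mulrA e) -be -(mulrA b) eE mulrA bE mulrBr mulr1 mulrA rscalC.
  by rewrite -mulrA ky mulr1 /k rscalB addrA.
move=> pd; have : S (inf S - dl) by split => //; lra.
have hlb : has_lbound S by exists 0.
by move=> /(ge_inf hlb); lra.
Qed.

Lemma invertible_of_lr x y z : x * y = 1 -> z * x = 1 -> invertible x.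
Proof.
move=> xy zx; exists y; split => //.
by have -> : y = z by rewrite -[y]mul1r -zx -mulrA xy mulr1.
Qed.

Lemma invertible_factor x y : x * y = y * x -> invertible (x * y) -> invertible x.
Proof.
move=> xy [z [xyz zxy]]; apply: (@invertible_of_lr _ (y * z) (z * y)).
  by rewrite mulrA.
by rewrite -mulrA -xy.
Qed.

(** If [z] inverts [x y + e], then [(1 - y z x) / e] inverts [y x + e]. This is the coincidence of
    the nonzero spectra of [x y] and [y x]. *)
Lemma invertible_addC x y e : e != 0 ->
  invertible (x * y + rscal e) -> invertible (y * x + rscal e).
Proof.
move=> e0 [z [rz lz]]; set E := rscal e in rz lz *.
have EC v : v * E = E * v by exact: rscalC.
pose E' := rscal e^-1.
have EE' : E * E' = 1 by rewrite -rscalM mulfV // rscal1.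
have E'E : E' * E = 1 by rewrite -rscalM mulVf // rscal1.
have E'C v : v * E' = E' * v by exact: rscalC.
exists (E' * (1 - y * z * x)); split.
  rewrite mulrA E'C -mulrA.
  have -> : (y * x + E) * (1 - y * z * x) =
     E + y * (1 - (x * y + E) * z) * x + (y * E - E * y) * z * x by ncring.
  by rewrite rz EC !subrr !(mulr0, mul0r) !addr0.
rewrite -mulrA.
have -> : (1 - y * z * x) * (y * x + E) =
     E + y * (1 - z * (x * y + E)) * x + y * z * (E * x - x * E) by ncring.
by rewrite lz EC !subrr !(mulr0, mul0r) !addr0.
Qed.

(** Factor [h + e] as [(s + e) (1 - (s - h) / (s + e))]; the subtracted term has norm at most
    [s / (s + e) < 1]. *)
Lemma pos_invertible h e : 0 < e -> pos h -> invertible (h + rscal e).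
Proof.
move=> e0 [_ [s hs]]; have s0 : 0 <= s by apply: le_trans hs; exact: cs_norm_ge0 HU _.
have se : 0 < s + e by lra.
have -> : h + rscal e = rscal (s + e) * (1 - rscal (s + e)^-1 * (rscal s - h)).
  rewrite mulrBr mulr1 mulrA -rscalM mulfV ?gt_eqF // rscal1 mul1r rscalD.
  by ncring.
apply: invertibleM; first by apply: invertible_rscal; rewrite gt_eqF.
apply: (invertible_1B HU); rewrite (norm_rscalM HU) gtr0_norm ?invr_gt0 //.
by rewrite mulrC ltr_pdivrMr // mul1r; lra.
Qed.

(** For [l = p + i q] with [q = 0], the real [p] is negative and [pos_invertible] applies. Otherwise
    [l - h = i q - x] with [x = h - p] self-adjoint, and multiplying by the commuting element
    [- (i q + x)] gives [x^2 + q^2], which is invertible. *)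
Lemma pos_resolvent h (l : R[i]) : pos h -> ~ (0 <= l) -> invertible (l%:A - h).
Proof.
case: l => p q ph; have sh := ph.1.
have [->|q0] := eqVneq q 0.
  rewrite lecE /= eqxx /= => /negP; rewrite -ltNge => p0.
  have [|y [hy yh]] := @pos_invertible h (- p) _ ph; first by rewrite oppr_gt0.
  exists (- y); rewrite mulrN mulNr.
  have E : (Complex p 0)%:A - h = - (h + rscal (- p)).
    by rewrite rscalN opprB.
  by rewrite E mulNr mulrN !opprK.
move=> _; pose x := h - rscal p; pose iq : U := 'i%C *: rscal q.
have sx : star x = x by rewrite /x (cs_starB HU) sh (star_rscal HU).
have xiq : x * iq = iq * x by rewrite /iq -scalerAr -scalerAl rscalC.
have iqiq : iq * iq = - rscal (q ^+ 2).
  by rewrite /iq -scalerAr -scalerAl scalerA mulii scaleN1r rscal_sqr.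
have -> : (Complex p q)%:A - h = iq - x.
  rewrite /x opprB addrA; congr (_ - _).
  rewrite /iq /rscal scalerA -scalerDl; congr (_ *: _).
  by rewrite [LHS]complexE addrC.
apply: (@invertible_factor _ (- (iq + x))).
  have -> : (iq - x) * - (iq + x) = - (iq + x) * (iq - x)
    + ((x * iq - iq * x) + (x * iq - iq * x)) by ncring.
  by rewrite xiq subrr !addr0.
have -> : (iq - x) * - (iq + x) = x * x + rscal (q ^+ 2).
  have -> : (iq - x) * - (iq + x) = x * x - iq * iq + (x * iq - iq * x) by ncring.
  by rewrite xiq subrr addr0 iqiq opprK.
by apply: pos_invertible (pos_sqr sx); rewrite exprn_even_gt0.
Qed.

Lemma pos_antisym h : pos h -> pos (- h) -> h = 0.
Proof.
move=> ph pnh; apply: (cs_eq_small HU (K := 1)) => e e0; rewrite subr0 mul1r.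
apply: pos_norm_le => //; first exact: ltW.
by apply: pos_add pnh; apply: pos_rscal; exact: ltW.
Qed.

Lemma sa_sqr_eq0 q : star q = q -> q * q = 0 -> q = 0.
Proof.
move=> sq q2; apply: (cs_norm_eq0 HU); apply/eqP; rewrite -sqrf_eq0 -norm_sqr //.
by rewrite q2 (cs_norm0 HU).
Qed.

(* With [h = x^* x], [c = |h|] and [q = c - h] twice the negative part of [h], the
   element [y = x q] satisfies [y^* y = - q c q <= 0]. As [y^* y + y y^*] is twice a sum of
   squares, [y y^* >= 0]; since [y^* y] and [y y^*] have the same nonzero spectrum,
   [y = 0], hence [q = 0]. *)
Lemma pos_star_mul x : pos (star x * x).
Proof.
set h := star x * x; have sh : star h = h by rewrite /h (cs_starM HU) (cs_starK HU).
have [c [pc cE cc]] := pos_sqrt HU (pos_sqr sh).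
have sc := pc.1.
have hc : h * c = c * h by apply: cc; rewrite mulrA.
pose q := c - h.
have sq : star q = q by rewrite /q (cs_starB HU) sc sh.
have qc : q * c = c * q by rewrite /q mulrBl mulrBr hc.
have hq : h * q = - (c * q).
  by rewrite /q mulrBr mulrBr cE hc opprB.
have qq : q * q = c * q + c * q.
  by rewrite {1}/q mulrBl hq opprK.
have [d [[sd _] dE dc]] := pos_sqrt HU pc.
have qd : q * d = d * q by exact: dc.
have pqcq : pos (q * c * q).
  have -> : q * c * q = (q * d) * (q * d).
    by rewrite -dE {2}qd !mulrA.
  by apply: pos_sqr; rewrite (cs_starM HU) sq sd qd.
pose y := x * q.
have yy : star y * y = - (q * c * q).
  have -> : star y * y = q * (h * q) by rewrite /y (cs_starM HU) sq /h !mulrA.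
  by rewrite hq mulrN mulrA.
have pyy : pos (y * star y).
  pose u := y + star y; pose v := 'i%C *: (y - star y).
  have su : star u = u by rewrite /u (cs_starD HU) (cs_starK HU) addrC.
  have sv : star v = v.
    rewrite /v (cs_starZ HU) (cs_starB HU) (cs_starK HU) -opprB scalerN -scaleNr.
    by congr (_ *: _); apply/eqP; rewrite eq_complex /= oppr0 opprK !eqxx.
  have vv : v * v = - ((y - star y) * (y - star y)).
    by rewrite /v -scalerAr -scalerAl scalerA mulii scaleN1r.
  have half w : rscal 2^-1 * (w + w) = w.
    rewrite mulrDr -mulrDl -rscalD (_ : 2^-1 + 2^-1 = 1 :> R) ?rscal1 ?mul1r //.
    by field.
  have -> : y * star y = rscal 2^-1 * (u * u + v * v) - star y * y.
    rewrite vv /u.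
    have -> : (y + star y) * (y + star y) - (y - star y) * (y - star y) =
      (y * star y + star y * y) + (y * star y + star y * y) by ncring.
    by rewrite half addrK.
  rewrite yy opprK; apply: pos_add pqcq.
  by apply: pos_rscalM; [rewrite invr_ge0|apply: pos_add; exact: pos_sqr].
have yy0 : star y * y = 0.
  apply: pos_antisym; last by rewrite yy opprK.
  apply: pos_of_invertible => [|e e0]; first by rewrite (cs_starM HU) (cs_starK HU).
  by apply: invertible_addC; [rewrite gt_eqF|exact: pos_invertible].
have qcq : q * c * q = 0 by apply/eqP; rewrite -oppr_eq0 -yy yy0.
(* Since [q^2 = 2 c q], the fourth power of [q] is [2 q (q c q) = 0]; a self-adjoint element of
   square 0 vanishes, and this is applied to [q^2] and then to [q]. *)
have q0 : q = 0.
  apply: sa_sqr_eq0 => //; apply: sa_sqr_eq0; first by rewrite (cs_starM HU) sq.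
  have -> : q * q * (q * q) = q * (q * c * q + q * c * q).
    by rewrite {2}qq -!mulrA mulrDr !mulrA.
  by rewrite qcq addr0 mulr0.
by move: q0; rewrite /q => /eqP; rewrite subr_eq0 => /eqP <-.
Qed.

Lemma pos_conj p c : pos p -> pos (star c * p * c).
Proof.
move=> /(pos_sqrt HU)[d [[sd _] <- _]].
have -> : star c * (d * d) * c = star (d * c) * (d * c).
  by rewrite (cs_starM HU) sd !mulrA.
exact: pos_star_mul.
Qed.

End PositiveCone.

(** * Completeness of the real and complex numbers *)

Section CauchyComplete.
Variable R : realType.

Lemma real_cauchy_complete (u : nat -> R) :
  (forall e : R, 0 < e -> exists N, forall m n, (N <= m)%N -> (N <= n)%N ->
     `|u m - u n| < e) ->
  exists l, forall e : R, 0 < e -> exists N, forall n, (N <= n)%N -> `|u n - l| < e.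
Proof.
(* [S] consists of the eventual lower bounds, so [sup S] is the limit inferior. *)
move=> uC; pose S := [set x | exists N, forall n, (N <= n)%N -> x <= u n].
have near e : 0 < e -> exists N,
    [/\ S (u N - e), ubound S (u N + e) & forall n, (N <= n)%N -> `|u n - u N| < e].
  move=> e0; have [N uN] := uC _ e0; exists N; split.
  - by exists N => n Nn; have := uN n N Nn (leqnn N); rewrite ltr_norml; lra.
  - move=> x [M xM]; have := xM _ (leq_maxr N M).
    by have := uN _ N (leq_maxl N M) (leqnn N); rewrite ltr_norml; lra.
  - by move=> n Nn; exact: uN.
exists (sup S) => e e0; have e20 : 0 < e / 2 by rewrite divr_gt0.
have [N [SN ubN uN]] := near _ e20; exists N => n /uN.
have : u N - e / 2 <= sup S by apply: ub_le_sup SN; exists (u N + e / 2).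
have : sup S <= u N + e / 2 by apply: ge_sup ubN; exists (u N - e / 2).
by rewrite !ltr_norml; lra.
Qed.

Lemma complex_cauchy_complete (u : nat -> R[i]) :
  (forall e : R, 0 < e -> exists N, forall m n, (N <= m)%N -> (N <= n)%N ->
     normc (u m - u n) < e) ->
  exists l, forall e : R, 0 < e -> exists N, forall n, (N <= n)%N -> normc (u n - l) < e.
Proof.
move=> uC.
have [p up] : exists l, forall e : R, 0 < e -> exists N, forall n, (N <= n)%N ->
    `|complex.Re (u n) - l| < e.
  apply: real_cauchy_complete => e /uC[N uN]; exists N => m n Nm Nn.
  by rewrite -raddfB (le_lt_trans (ler_norm_Re_normc _)) ?uN.
have [q uq] : exists l, forall e : R, 0 < e -> exists N, forall n, (N <= n)%N ->
    `|complex.Im (u n) - l| < e.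
  apply: real_cauchy_complete => e /uC[N uN]; exists N => m n Nm Nn.
  by rewrite -raddfB (le_lt_trans (ler_norm_Im_normc _)) ?uN.
exists (Complex p q) => e e0; have e20 : 0 < e / 2 by rewrite divr_gt0.
have [N uN] := up _ e20; have [M uM] := uq _ e20.
exists (maxn N M) => n; rewrite geq_max => /andP[/uN pn /uM qn].
apply: (le_lt_trans (normc_le _)); rewrite !raddfB /=.
by move: pn qn; lra.
Qed.

End CauchyComplete.

(** * Adjoining a unit to a C*-algebra *)

Section Unitization.
Variables (R : realType) (A : lmodType R[i])
  (mul : A -> A -> A) (star : A -> A) (norm : A -> R).

(** The proof is a parameter of the type so that the canonical ring structure, which depends on
    [mul] and its laws, can be found from the type alone. *)
Definition unitization of is_Cstar_algebra mul star norm : Type := (A * R[i]^o)%type.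

Variable HA : is_Cstar_algebra mul star norm.
Local Notation U := (unitization HA).
Local Notation "x ** y" := (mul x y) (at level 40, left associativity).

HB.instance Definition _ := GRing.Lmodule.copy U (A * R[i]^o)%type.

Definition umul (x y : U) : U :=
  (x.1 ** y.1 + y.2 *: x.1 + x.2 *: y.1, x.2 * y.2).
Definition uone : U := (0, 1).
Definition ustar (x : U) : U := (star x.1, conjc x.2).

Lemma cs_mul0l x : 0 ** x = 0.
Proof. by rewrite -{1}(scale0r (0 : A)) (cs_mulZl HA) scale0r. Qed.
Lemma cs_mul0r x : x ** 0 = 0.
Proof. by rewrite -{1}(scale0r (0 : A)) (cs_mulZr HA) scale0r. Qed.

Lemma unitization_ext (x y : U) : x.1 = y.1 -> x.2 = y.2 -> x = y.
Proof. by case: x y => [x1 x2] [y1 y2] /= -> ->. Qed.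

Lemma umulA : associative umul.
Proof.
move=> x y z; apply: unitization_ext => /=; last exact: mulrA.
rewrite !(cs_mulDl HA, cs_mulDr HA, cs_mulZl HA, cs_mulZr HA, scalerDr) (cs_mulA HA).
rewrite !scalerA !addrA (mulrC z.2 y.2) (mulrC z.2 x.2).
by rewrite [LHS](ACl (1*3*5*2*4*6*7)%AC).
Qed.

Lemma umul1l : left_id uone umul.
Proof.
move=> x; apply: unitization_ext => /=; last exact: mul1r.
by rewrite cs_mul0l scaler0 scale1r !add0r.
Qed.

Lemma umul1r : right_id uone umul.
Proof.
move=> x; apply: unitization_ext => /=; last exact: mulr1.
by rewrite cs_mul0r scaler0 scale1r add0r addr0.
Qed.

Lemma umulDl : left_distributive umul +%R.
Proof.
move=> x y z; apply: unitization_ext => /=; last exact: mulrDl.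
rewrite (cs_mulDl HA) scalerDr scalerDl !addrA.
by rewrite [LHS](ACl (1*3*5*2*4*6)%AC).
Qed.

Lemma umulDr : right_distributive umul +%R.
Proof.
move=> x y z; apply: unitization_ext => /=; last exact: mulrDr.
rewrite (cs_mulDr HA) scalerDr scalerDl !addrA.
by rewrite [LHS](ACl (1*3*5*2*4*6)%AC).
Qed.

Lemma uone_neq0 : uone != 0.
Proof. by apply/eqP => -[] /eqP; rewrite oner_eq0. Qed.

HB.instance Definition _ := GRing.Zmodule_isNzRing.Build U
  umulA umul1l umul1r umulDl umulDr uone_neq0.

Lemma umulZl (c : R[i]) (x y : U) : c *: (x * y) = (c *: x) * y.
Proof.
apply: unitization_ext => /=; last exact: mulrA.
by rewrite (cs_mulZl HA) !scalerDr !scalerA (mulrC y.2).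
Qed.

HB.instance Definition _ := GRing.Lmodule_isLalgebra.Build R[i] U umulZl.

Lemma umulZr (c : R[i]) (x y : U) : c *: (x * y) = x * (c *: y).
Proof.
apply: unitization_ext => /=; last exact: mulrCA.
by rewrite (cs_mulZr HA) !scalerDr !scalerA (mulrC c x.2).
Qed.

HB.instance Definition _ := GRing.Lalgebra_isAlgebra.Build R[i] U umulZr.

(** Left multiplication by [x] on the ideal [A]; its operator norm is the source of the norm of the
    unitization. *)
Definition act (x : U) (y : A) : A := x.1 ** y + x.2 *: y.

Lemma actDl x x' y : act (x + x') y = act x y + act x' y.
Proof. by rewrite /act /= (cs_mulDl HA) scalerDl addrACA. Qed.
Lemma actZl c x y : act (c *: x) y = c *: act x y.
Proof. by rewrite /act /= (cs_mulZl HA) scalerDr scalerA. Qed.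
Lemma actZr c x y : act x (c *: y) = c *: act x y.
Proof. by rewrite /act /= (cs_mulZr HA) scalerDr !scalerA mulrC. Qed.
Lemma actM x x' y : act (x * x') y = act x (act x' y).
Proof.
rewrite /act /= !(cs_mulDl HA, cs_mulDr HA, cs_mulZl HA, cs_mulZr HA, scalerDr).
rewrite (cs_mulA HA) scalerA !addrA.
by congr (_ + _); rewrite addrAC.
Qed.

Lemma star_act x y z : star (act x y) ** z = star y ** act (ustar x) z.
Proof.
rewrite /act /= (cs_starD HA) (cs_starM HA) (cs_starZ HA) (cs_mulDl HA).
by rewrite (cs_mulDr HA) (cs_mulA HA) (cs_mulZl HA) (cs_mulZr HA).
Qed.

Lemma norm_act_le x y : norm (act x y) <= (norm x.1 + normc x.2) * norm y.
Proof.
apply: (le_trans (cs_normD HA _ _)); rewrite [leRHS]mulrDl (cs_normZ HA).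
by rewrite lerD2r (cs_normM HA).
Qed.

Definition opnorm (x : U) : R :=
  sup [set r : R | exists y, norm y <= 1 /\ r = norm (act x y)].

Let opset x := [set r : R | exists y, norm y <= 1 /\ r = norm (act x y)].

Lemma opset0 x : opset x 0.
Proof.
exists 0; rewrite (cs_norm0 HA); split => //.
by rewrite /act cs_mul0r scaler0 addr0 (cs_norm0 HA).
Qed.

Lemma opset_ub x : has_ubound (opset x).
Proof.
exists (norm x.1 + normc x.2) => _ [y [y1 ->]].
apply: (le_trans (norm_act_le _ _)).
by rewrite ler_piMr // addr_ge0 ?normc_ge0 // (cs_norm_ge0 HA).
Qed.

Lemma opnorm_ge0 x : 0 <= opnorm x.
Proof. by apply: ub_le_sup (opset_ub x) _ (opset0 x). Qed.

Lemma norm_act x y : norm (act x y) <= opnorm x * norm y.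
Proof.
have [y0|y0] := eqVneq (norm y) 0.
  by apply: (le_trans (norm_act_le _ _)); rewrite y0 !mulr0.
have yp : 0 < norm y by rewrite lt_def y0 (cs_norm_ge0 HA).
rewrite -ler_pdivrMr // mulrC; apply: ub_le_sup (opset_ub x) _ _.
exists ((norm y)^-1%:C%C *: y); rewrite actZr !(cs_norm_realZ HA).
by rewrite gtr0_norm ?invr_gt0 // mulVf.
Qed.

Lemma opnorm_le x K : 0 <= K -> (forall y, norm (act x y) <= K * norm y) -> opnorm x <= K.
Proof.
move=> K0 xK; apply: ge_sup; first by exists 0; exact: opset0.
move=> _ [y [y1 ->]]; apply: (le_trans (xK y)).
by rewrite ler_piMr.
Qed.

Lemma opnorm_le_sum x : opnorm x <= norm x.1 + normc x.2.
Proof.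
apply: opnorm_le => [|y]; last exact: norm_act_le.
by rewrite addr_ge0 ?normc_ge0 // (cs_norm_ge0 HA).
Qed.

Lemma opnormD x y : opnorm (x + y) <= opnorm x + opnorm y.
Proof.
apply: opnorm_le => [|z]; first by rewrite addr_ge0 ?opnorm_ge0.
rewrite actDl mulrDl; apply: (le_trans (cs_normD HA _ _)).
by rewrite lerD ?norm_act.
Qed.

Lemma opnormZ_le c x : opnorm (c *: x) <= normc c * opnorm x.
Proof.
apply: opnorm_le => [|z]; first by rewrite mulr_ge0 ?opnorm_ge0 ?normc_ge0.
by rewrite actZl (cs_normZ HA) -mulrA ler_wpM2l ?normc_ge0 ?norm_act.
Qed.

Lemma opnormZ c x : opnorm (c *: x) = normc c * opnorm x.
Proof.
have [->|c0] := eqVneq c 0.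
  apply/eqP; rewrite eq_le opnormZ_le ComplexField.Normc.normc0 mul0r.
  exact: opnorm_ge0.
apply/eqP; rewrite eq_le opnormZ_le /=.
have nc : 0 < normc c.
  rewrite lt_def normc_ge0 andbT; apply: contra c0 => /eqP.
  by move=> /ComplexField.Normc.eq0_normc ->.
rewrite mulrC -ler_pdivlMr // mulrC -ComplexField.Normc.normcV.
by have := opnormZ_le c^-1 (c *: x); rewrite scalerA mulVf // scale1r.
Qed.

Lemma opnormM x y : opnorm (x * y) <= opnorm x * opnorm y.
Proof.
apply: opnorm_le => [|z]; first by rewrite mulr_ge0 ?opnorm_ge0.
rewrite actM; apply: (le_trans (norm_act _ _)).
by rewrite -mulrA ler_wpM2l ?opnorm_ge0 ?norm_act.
Qed.

(** For [y] in [A], the C*-identity of [A] turns [norm (act x y) ^+ 2] into the norm of [star y]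
    times [act (ustar x * x) y]. *)
Lemma opnorm_sqr_le x : opnorm x ^+ 2 <= opnorm (ustar x * x).
Proof.
rewrite -[leRHS]sqr_sqrtr ?opnorm_ge0 // ler_pXn2r ?nnegrE ?sqrtr_ge0 ?opnorm_ge0 //.
apply: opnorm_le => [|y]; first exact: sqrtr_ge0.
rewrite -(@ler_pXn2r _ 2) ?nnegrE ?mulr_ge0 ?sqrtr_ge0 ?(cs_norm_ge0 HA) //.
rewrite exprMn sqr_sqrtr ?opnorm_ge0 // -(cs_Cstar HA) star_act -actM.
apply: (le_trans (cs_normM HA _ _)); rewrite (cs_norm_star HA).
by rewrite mulrC expr2 mulrA ler_wpM2r ?norm_act // (cs_norm_ge0 HA).
Qed.

Lemma opnorm_star x : opnorm (ustar x) = opnorm x.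
Proof.
have H y : opnorm y <= opnorm (ustar y).
  have [->|y0] := eqVneq (opnorm y) 0; first exact: opnorm_ge0.
  have yp : 0 < opnorm y by rewrite lt_def y0 opnorm_ge0.
  by rewrite -(ler_pM2r yp) -expr2 (le_trans (opnorm_sqr_le _)) ?opnormM.
have starK y : ustar (ustar y) = y.
  by apply: unitization_ext; rewrite /= ?(cs_starK HA) ?conjcK.
by apply/eqP; rewrite eq_le H -{2}(starK x) H.
Qed.

Lemma opnorm_Cstar x : opnorm (ustar x * x) = opnorm x ^+ 2.
Proof.
apply/eqP; rewrite eq_le opnorm_sqr_le andbT.
by apply: (le_trans (opnormM _ _)); rewrite opnorm_star expr2.
Qed.

Definition inj_unit (x : A) : U := (x, 0).

(** The lower bound comes from letting [x] act on [star x], where the C*-identity gives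
    [norm x ^+ 2]. *)
Lemma opnorm_inj x : opnorm (inj_unit x) = norm x.
Proof.
apply/eqP; rewrite eq_le (le_trans (opnorm_le_sum _)) ?ComplexField.Normc.normc0 ?addr0 //=.
have [->|x0] := eqVneq (norm x) 0; first exact: opnorm_ge0.
have xp : 0 < norm x by rewrite lt_def x0 (cs_norm_ge0 HA).
rewrite -(ler_pM2r xp) -{3}(cs_norm_star HA x) (le_trans _ (norm_act _ _)) //.
rewrite /act /= scale0r addr0 -{3}[x](cs_starK HA) (cs_Cstar HA).
by rewrite (cs_norm_star HA) expr2.
Qed.

(* The component [normc x.2] makes this a norm also when [A] already has a unit. *)
Definition unorm (x : U) : R := Num.max (opnorm x) (normc x.2).

Lemma unorm_inj x : unorm (inj_unit x) = norm x.
Proof.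
by rewrite /unorm opnorm_inj ComplexField.Normc.normc0 max_l // (cs_norm_ge0 HA).
Qed.

Lemma max_mul_le (a b a' b' : R) : 0 <= a -> 0 <= b -> 0 <= a' -> 0 <= b' ->
  Num.max (a * a') (b * b') <= Num.max a b * Num.max a' b'.
Proof.
move=> a0 b0 a'0 b'0; rewrite ge_max; apply/andP; split.
  by rewrite ler_pM // le_max lexx.
by rewrite ler_pM // le_max lexx orbT.
Qed.

Lemma unitization_Cstar : is_Cstar_algebra (A := U) *%R ustar unorm.
Proof.
have unormD x y : unorm (x + y) <= unorm x + unorm y.
  rewrite /unorm ge_max; apply/andP; split.
    apply: (le_trans (opnormD _ _)).
    by rewrite lerD // le_max lexx.
  apply: (le_trans (normc_triangle _ _)).
  by rewrite lerD // le_max lexx orbT.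
(* Subtracting the scalar part from [x] leaves [x.1], and the unit has operator norm at most 1. This
   control of the first component yields definiteness and, componentwise, completeness. *)
have norm1_le (x : U) : norm x.1 <= unorm x + unorm x.
  rewrite -opnorm_inj.
  have -> : inj_unit x.1 = x + (- x.2) *: uone.
    apply: unitization_ext => /=; first by rewrite scaler0 addr0.
    by rewrite -[_ *: 1]/(- x.2 * 1) mulr1 subrr.
  apply: (le_trans (opnormD _ _)); apply: lerD; first by rewrite le_max lexx.
  rewrite opnormZ normc_N; apply: (@le_trans _ _ (normc x.2)); last first.
    by rewrite le_max lexx orbT.
  rewrite ler_piMr ?normc_ge0 // (le_trans (opnorm_le_sum _)) //.
  by rewrite (cs_norm0 HA) ComplexField.Normc.normc1 add0r.
split.
- exact: mulrA.
- exact: mulrDl.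
- exact: mulrDr.
- by move=> c x y; rewrite scalerAl.
- by move=> c x y; rewrite scalerAr.
- move=> x x0; apply: unitization_ext => /=.
    apply: (cs_norm_eq0 HA); apply/eqP; rewrite eq_le (cs_norm_ge0 HA) andbT.
    by rewrite (le_trans (norm1_le x)) // x0 addr0.
  apply: ComplexField.Normc.eq0_normc; apply/eqP; rewrite eq_le normc_ge0 andbT.
  by rewrite -x0 le_max lexx orbT.
- exact: unormD.
- move=> c x; rewrite /unorm opnormZ /= -[_ *: x.2]/(c * x.2).
  by rewrite ComplexField.Normc.normcM maxr_pMr ?normc_ge0.
- move=> x y; rewrite /unorm; apply: (@le_trans _ _
     (Num.max (opnorm x * opnorm y) (normc x.2 * normc y.2))).
    rewrite ge_max !le_max opnormM /= -ComplexField.Normc.normcM.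
    by rewrite lexx orbT.
  by rewrite max_mul_le ?opnorm_ge0 ?normc_ge0.
- move=> u uC.
  have [l1 ul1] : exists l, forall e : R, 0 < e -> exists N, forall n, (N <= n)%N ->
      norm ((u n).1 - l) < e.
    apply: (cs_complete HA) => e e0; have [N uN] := uC (e / 2) (divr_gt0 e0 (ltr0n _ 2)).
    exists N => m n Nm Nn; apply: (le_lt_trans (norm1_le (u m - u n))).
    by have := uN m n Nm Nn; lra.
  have [l2 ul2] : exists l, forall e : R, 0 < e -> exists N, forall n, (N <= n)%N ->
      normc ((u n).2 - l) < e.
    apply: complex_cauchy_complete => e e0; have [N uN] := uC _ e0.
    exists N => m n Nm Nn; apply: le_lt_trans (uN m n Nm Nn).
    by rewrite /unorm le_max lexx orbT.
  exists ((l1, l2) : U) => e e0; have e20 : 0 < e / 2 by rewrite divr_gt0.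
  have [N uN] := ul1 _ e20; have [M uM] := ul2 _ e20.
  exists (maxn N M) => n; rewrite geq_max => /andP[/uN pn /uM qn].
  rewrite /unorm gt_max (le_lt_trans (opnorm_le_sum _)) /=; last by move: pn qn; lra.
  by move: qn; lra.
- by move=> x; apply: unitization_ext; rewrite /= ?(cs_starK HA) ?conjcK.
- by move=> x y; apply: unitization_ext; rewrite /= ?(cs_starD HA) ?rmorphD.
- move=> c x; apply: unitization_ext; rewrite /= ?(cs_starZ HA) //.
  by rewrite -[_ *: x.2]/(c * x.2) rmorphM.
- move=> x y; apply: unitization_ext => /=; last by rewrite rmorphM mulrC.
  rewrite !(cs_starD HA) (cs_starM HA) !(cs_starZ HA).
  by rewrite addrAC.
- move=> x; rewrite /unorm opnorm_Cstar /= ComplexField.Normc.normcM normc_conj.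
  rewrite -expr2; case: (leP (opnorm x) (normc x.2)) => h.
    by rewrite max_r // ler_pXn2r ?nnegrE ?opnorm_ge0 ?normc_ge0.
  by rewrite max_l // ler_pXn2r ?nnegrE ?opnorm_ge0 ?normc_ge0 // ltW.
Qed.

End Unitization.

(** * Spectral positivity in [A] versus positivity in the unitization *)

Section PositivityTransfer.
Variables (R : realType) (A : lmodType R[i])
  (mul : A -> A -> A) (star : A -> A) (norm : A -> R).
Variable HA : is_Cstar_algebra mul star norm.
Local Notation U := (unitization HA).
Local Notation HU := (unitization_Cstar HA).
Local Notation "x ** y" := (mul x y) (at level 40, left associativity).
Local Notation iota := (inj_unit HA).
Local Notation upos := (pos (@ustar _ _ _ _ _ HA) (@unorm _ _ _ _ _ HA)).

Lemma inj_unitD x y : iota (x + y) = iota x + iota y.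
Proof. by apply: unitization_ext; rewrite /= ?addr0. Qed.
Lemma inj_unitN x : iota (- x) = - iota x.
Proof. by apply: unitization_ext; rewrite /= ?oppr0. Qed.
Lemma inj_unitB x y : iota (x - y) = iota x - iota y.
Proof. by rewrite inj_unitD inj_unitN. Qed.
Lemma inj_unit0 : iota 0 = 0.
Proof. by []. Qed.
Lemma inj_unitZ c x : iota (c *: x) = c *: iota x.
Proof. by apply: unitization_ext; rewrite /= ?scaler0. Qed.
Lemma inj_unitM x y : iota (x ** y) = iota x * iota y.
Proof. by apply: unitization_ext; rewrite /= ?scale0r ?addr0 ?mul0r. Qed.
Lemma inj_unit_star x : iota (star x) = ustar (iota x).
Proof. by apply: unitization_ext; rewrite /= ?conjc0 ?oppr0. Qed.
Lemma inj_unit_rscal r x : iota (r%:C%C *: x) = rscal U r * iota x.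
Proof. by rewrite inj_unitZ rscalE. Qed.
Lemma inj_unit_inj x y : iota x = iota y -> x = y.
Proof. by case. Qed.
Lemma inj_unit_fst (x : U) : x.2 = 0 -> iota x.1 = x.
Proof. by move=> x2; exact: unitization_ext. Qed.

(** If the spectrum is nonnegative, it omits [- e] for every [e > 0], so a quasi-inverse of
    [- x / e] gives an inverse of [x + e] and [pos_of_invertible] applies. Conversely,
    [pos_resolvent] inverts [l - x] for every [l] that is not nonnegative. *)
Lemma Cstar_posP x : Cstar_pos mul star x <-> upos (iota x).
Proof.
split=> [[sx spx]|px].
- apply: (pos_of_invertible HU) => [|e e0]; first by rewrite -inj_unit_star sx.
  pose l : R[i] := (- e)%:C%C.
  have l0 : l != 0 by rewrite fmorph_eq0 oppr_eq0 gt_eqF.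
  have /contrapT[y [ry ly]] : ~ ~ quasi_invertible mul (l^-1 *: x).
    move=> nq; have /spx : spectrum mul x l by right.
    by rewrite ler0c oppr_ge0 leNgt e0.
  set x' := l^-1 *: x in ry ly.
  have -> : iota x + rscal U e = rscal U e * (1 - iota x').
    rewrite mulrBr mulr1 rscalE /x' inj_unitZ scalerA addrC; congr (_ + _).
    rewrite -scaleNr -[LHS]scale1r; congr (_ *: _).
    by rewrite /l rmorphN invrN mulrN opprK mulfV // fmorph_eq0 gt_eqF.
  apply: invertibleM; first by apply: invertible_rscal; rewrite gt_eqF.
  move: ry ly => /(congr1 iota) ry /(congr1 iota) ly.
  rewrite inj_unitB inj_unitD inj_unitM inj_unit0 in ry.
  rewrite inj_unitB inj_unitD inj_unitM inj_unit0 in ly.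
  exists (1 - iota y); split.
    have -> : (1 - iota x') * (1 - iota y) =
      1 - (iota x' + iota y - iota x' * iota y) by ncring.
    by rewrite ry subr0.
  have -> : (1 - iota y) * (1 - iota x') =
    1 - (iota y + iota x' - iota y * iota x') by ncring.
  by rewrite ly subr0.
- split; first by apply: inj_unit_inj; rewrite inj_unit_star px.1.
  move=> l [->//|nq]; apply: contrapT => l0; apply: nq.
  have ln0 : l != 0 by apply: contra_notN l0 => /eqP ->.
  have [z [rz lz]] := pos_resolvent HU px l0.
  have E : l%:A - iota x = l *: (1 - iota (l^-1 *: x)).
    by rewrite scalerBr inj_unitZ scalerA mulfV // scale1r.
  set x' := l^-1 *: x in E *.
  rewrite E -scalerAl scalerAr in rz; rewrite E -scalerAr scalerAl in lz.
  set w := l *: z in rz lz.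
  (* The inverse [w] of [1 - x / l] has scalar part 1, so [1 - w] lies in [A], where it is the
     quasi-inverse sought. *)
  have w2 : (1 - w).2 = 0.
    have := congr1 snd rz; rewrite /= subr0 mul1r => ->.
    exact: subrr.
  exists (1 - w).1; split; apply: inj_unit_inj;
    rewrite inj_unitB inj_unitD inj_unitM inj_unit_fst // inj_unit0.
    have -> : iota x' + (1 - w) - iota x' * (1 - w) = 1 - (1 - iota x') * w by ncring.
    by rewrite rz subrr.
  have -> : (1 - w) + iota x' - (1 - w) * iota x' = 1 - w * (1 - iota x') by ncring.
  by rewrite lz subrr.
Qed.

(** A root of [iota a] exists in the unitization. Its scalar part squares to 0, so it lies in [A],
    and the choice made by [epsilon] is meaningful. *)
Lemma Cstar_sqrtP a : Cstar_pos mul star a ->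
  Cstar_pos mul star (Cstar_sqrt mul star a) /\
  Cstar_sqrt mul star a ** Cstar_sqrt mul star a = a.
Proof.
move=> pa; pose P b := Cstar_pos mul star b /\ b ** b = a.
suff /(ClassicalEpsilon.epsilon_spec (inhabits 0)) : exists b, P b by [].
have [d [pd dE _]] := pos_sqrt HU ((Cstar_posP a).1 pa).
have d2 : d.2 = 0.
  by have := congr1 snd dE => /= /eqP; rewrite mulf_eq0 orbb => /eqP.
exists d.1; split; first by apply/Cstar_posP; rewrite inj_unit_fst.
by apply: inj_unit_inj; rewrite inj_unitM inj_unit_fst.
Qed.

End PositivityTransfer.

(** * Hahn-Banach for real-linear functionals *)

Section HahnBanach.
Variables (R : realType) (V : lmodType R[i]).
Implicit Types (p q : V -> R) (x y : V) (r t : R).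
Local Notation "r *r x" := (r%:C%C *: x) (at level 40).

(** Homogeneity is an inequality for [r > 0] only, which is lighter to check; applying it to [r^-1]
    gives equality. Scalars are real although [V] is a complex space. *)
Definition sublinear p := (forall x y, p (x + y) <= p x + p y) /\
  (forall r x, 0 < r -> p (r *r x) <= r * p x).

Lemma sublinear0 p : sublinear p -> p 0 = 0.
Proof.
move=> [pD pZ]; have := pD 0 0; rewrite addr0.
have h : 0 < (2^-1 : R) by rewrite invr_gt0.
by have := pZ _ 0 h; rewrite scaler0; lra.
Qed.

Lemma sublinearZ p r x : sublinear p -> 0 <= r -> p (r *r x) = r * p x.
Proof.
move=> sp; rewrite le_eqVlt => /orP[/eqP <-|r0].
  by rewrite scale0r sublinear0 // mul0r.
have [pD pZ] := sp; apply/eqP; rewrite eq_le pZ //=.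
have ri : 0 < r^-1 by rewrite invr_gt0.
have := pZ r^-1 (r *r x) ri.
rewrite scalerA -rmorphM mulVf ?gt_eqF // scale1r => h.
by rewrite mulrC -ler_pdivlMr // mulrC.
Qed.

Lemma sublinear_opp p x : sublinear p -> - p (- x) <= p x.
Proof.
by move=> sp; have := sp.1 x (- x); rewrite subrr (sublinear0 sp); lra.
Qed.

(* A pointwise minimal sublinear [q] is additive: comparing [q] with
   [x |-> inf_(t >= 0) (q (x + t y) - t q y)] gives [q x + q y <= q (x + y)]. *)
Lemma minimal_sublinear_additive q : sublinear q ->
  (forall q', sublinear q' -> (forall x, q' x <= q x) -> q' = q) ->
  forall x y, q (x + y) = q x + q y.
Proof.
move=> sq qmin x0 y; apply/eqP; rewrite eq_le sq.1 /=.
pose T x := [set s : R | exists2 t, 0 <= t & s = q (x + t *r y) - t * q y].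
have Tlb x : lbound (T x) (- q (- x)).
  move=> _ [t t0 ->]; have := sq.1 (x + t *r y) (- x).
  by rewrite addrAC subrr add0r (sublinearZ _ sq) //; lra.
have hlb x : has_lbound (T x) by exists (- q (- x)).
have T0 x : T x !=set0 by exists (q (x + 0 *r y) - 0 * q y), 0.
pose q' x := inf (T x).
have q'le x s : T x s -> q' x <= s by exact: ge_inf (hlb x) _.
have sq' : sublinear q'.
  split=> [x x'|r x r0].
    rewrite -lerBlDr; apply: lb_le_inf => // _ [t t0 ->].
    rewrite lerBlDr -lerBlDl; apply: lb_le_inf => // _ [t' t'0 ->].
    rewrite lerBlDl; apply: (@le_trans _ _ (q (x + x' + (t + t') *r y) - (t + t') * q y)).
      by apply: q'le; exists (t + t') => //; exact: addr_ge0.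
    rewrite rmorphD scalerDl addrACA.
    by have := sq.1 (x + t *r y) (x' + t' *r y); lra.
  rewrite mulrC -ler_pdivrMr //; apply: lb_le_inf => // _ [t t0 ->].
  rewrite ler_pdivrMr //.
  apply: (@le_trans _ _ (q (r *r x + (r * t) *r y) - r * t * q y)).
    by apply: q'le; exists (r * t) => //; rewrite mulr_ge0 // ltW.
  rewrite rmorphM -scalerA -scalerDr (sublinearZ _ sq (ltW r0)).
  by have -> : forall s, r * s - r * t * q y = (s - t * q y) * r by move=> s; ring.
have q'q : q' = q.
  apply: qmin => // x; apply: q'le; exists 0 => //.
  by rewrite scale0r addr0 mul0r subr0.
have : q' x0 <= q (x0 + 1 *r y) - 1 * q y by apply: q'le; exists 1.
by rewrite q'q scale1r mul1r; lra.
Qed.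

(** Instead of extending from subspaces, Zorn's lemma gives a minimal sublinear functional below
    [p], which is additive and hence real-linear. A nonempty chain is bounded by its pointwise
    infimum, finite because every member is at least [- p (- x)] at [x]. *)
Lemma hahn_banach p : sublinear p -> exists G : V -> R,
  [/\ forall x y, G (x + y) = G x + G y, forall r x, G (r *r x) = r * G x
    & forall x, G x <= p x].
Proof.
move=> sp; pose T := {q : V -> R | sublinear q /\ forall x, q x <= p x}.
pose le (q1 q2 : T) := `[< forall x, sval q2 x <= sval q1 x >].
have valI (q1 q2 : T) : sval q1 = sval q2 -> q1 = q2.
  by case: q1 q2 => [q1 h1] [q2 h2] /= e; exact: eq_exist.
have [q qmax] : exists q : T, forall q' : T, le q q' -> q' = q.
  apply: Zorn.
  - by move=> q; apply/asboolP.
  - move=> q1 q2 q3 /asboolP h12 /asboolP h23; apply/asboolP => x.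
    exact: le_trans (h23 x) (h12 x).
  - move=> q1 q2 /asboolP h12 /asboolP h21; apply: valI; apply/funext => x.
    by apply/eqP; rewrite eq_le h12 h21.
  move=> C tC; have [[q0 Cq0]|C0] := pselect (exists q : T, C q); last first.
    have pp : sublinear p /\ forall x, p x <= p x by split.
    by exists (exist _ p pp) => q Cq; case: C0; exists q.
  pose S x := [set s | exists2 q : T, C q & s = sval q x].
  have S0 x : S x !=set0 by exists (sval q0 x), q0.
  have Slb x : has_lbound (S x).
    exists (- p (- x)) => _ [[q [sq qp]] Cq ->] /=.
    by have := sublinear_opp x sq; have := qp (- x); lra.
  pose m x := inf (S x).
  have mle x (q : T) : C q -> m x <= sval q x.
    by move=> Cq; apply: ge_inf (Slb x) _ _; exists q.
  have sm : sublinear m.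
    split=> [x y|r x r0].
      rewrite -lerBlDr; apply: lb_le_inf => // _ [q1 C1 ->].
      rewrite lerBlDr -lerBlDl; apply: lb_le_inf => // _ [q2 C2 ->].
      rewrite lerBlDl.
      have [/asboolP h|/asboolP h] := tC _ _ C1 C2.
        have := mle (x + y) _ C2; have := (svalP q2).1.1 x y; have := h x; lra.
      by have := mle (x + y) _ C1; have := (svalP q1).1.1 x y; have := h y; lra.
    rewrite mulrC -ler_pdivrMr //; apply: lb_le_inf => // _ [q1 C1 ->].
    rewrite ler_pdivrMr //; apply: (le_trans (mle _ _ C1)).
    by rewrite [leRHS]mulrC; exact: (svalP q1).1.2.
  have mp x : m x <= p x by apply: le_trans (mle x _ Cq0) ((svalP q0).2 x).
  by exists (exist _ m (conj sm mp)) => q Cq; apply/asboolP => x /=; exact: mle.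
have [sq qp] := svalP q.
have qD : forall x y, sval q (x + y) = sval q x + sval q y.
  apply: minimal_sublinear_additive => // q' sq' q'q.
  have q'p x : q' x <= p x by exact: le_trans (q'q x) (qp x).
  have := qmax (exist _ q' (conj sq' q'p)).
  by move=> /(_ (introT (asboolP _) q'q)) /(congr1 sval).
have qN x : sval q (- x) = - sval q x.
  by have := qD x (- x); rewrite subrr (sublinear0 sq); lra.
exists (sval q); split => // r x.
have [r0|r0] := leP 0 r; first exact: sublinearZ.
rewrite -[r]opprK rmorphN scaleNr qN (sublinearZ _ sq) ?mulNr //.
by rewrite oppr_ge0 ltW.
Qed.

End HahnBanach.

(** * Hermitian functionals and their decompositions *)

Section HermitianFunctional.
Variables (R : realType) (A : lmodType R[i])
  (mul : A -> A -> A) (star : A -> A) (norm : A -> R).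
Variable HA : is_Cstar_algebra mul star norm.
Local Notation U := (unitization HA).
Local Notation HU := (unitization_Cstar HA).
Local Notation "x ** y" := (mul x y) (at level 40, left associativity).
Local Notation iota := (inj_unit HA).
Local Notation upos := (pos (@ustar _ _ _ _ _ HA) (@unorm _ _ _ _ _ HA)).
Local Notation rs := (rscal U).
Local Notation Re := complex.Re.

(** The self-adjoint part of [x]. Composing with it extends functionals of self-adjoint elements to
    all of [A], where [hahn_banach] can be applied. *)
Definition herm (x : A) : A := (2^-1)%:C%C *: (x + star x).

Lemma halfD (x : A) : (2^-1)%:C%C *: (x + x) = x.
Proof.
rewrite -[x in X in _ *: X]scale1r -scalerDl scalerA -[RHS]scale1r; congr (_ *: _).
by rewrite -(rmorph1 (real_complex R)) -rmorphD -rmorphM; congr (_%:C)%C; field.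
Qed.

Lemma star_herm x : star (herm x) = herm x.
Proof. by rewrite (cs_starZ HA) conjc_real (cs_starD HA) (cs_starK HA) addrC. Qed.

Lemma herm_id x : star x = x -> herm x = x.
Proof. by move=> sx; rewrite /herm sx halfD. Qed.

Lemma herm_skew x : star x = - x -> herm x = 0.
Proof. by move=> sx; rewrite /herm sx subrr scaler0. Qed.

Lemma hermD x y : herm (x + y) = herm x + herm y.
Proof. by rewrite /herm (cs_starD HA) addrACA scalerDr. Qed.

Lemma herm_realZ (r : R) x : herm (r%:C%C *: x) = r%:C%C *: herm x.
Proof.
by rewrite /herm (cs_starZ HA) conjc_real -scalerDr !scalerA mulrC.
Qed.

Lemma norm_herm x : norm (herm x) <= norm x.
Proof.
rewrite (cs_norm_realZ HA) gtr0_norm ?invr_gt0 //.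
by have := cs_normD HA x (star x); rewrite (cs_norm_star HA); lra.
Qed.

Lemma inj_unit_sa x : star x = x -> ustar (iota x) = iota x.
Proof. by move=> sx; rewrite -inj_unit_star sx. Qed.

Lemma sa_of_upos x : upos (iota x) -> star x = x.
Proof.
by move=> px; apply: (@inj_unit_inj _ _ _ _ _ HA); rewrite inj_unit_star px.1.
Qed.

Section Functional.
Variable f : A -> R[i].
Hypothesis Hf : hermitian_functional star norm f.

Lemma functD x y : f (x + y) = f x + f y.
Proof. exact: Hf.1.1.1. Qed.
Lemma functZ c x : f (c *: x) = c * f x.
Proof. exact: Hf.1.1.2. Qed.
Lemma funct_star x : f (star x) = conjc (f x).
Proof. exact: Hf.2. Qed.
Lemma funct0 : f 0 = 0.
Proof. by rewrite -(scale0r (0 : A)) functZ mul0r. Qed.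

Lemma Re_functD x y : Re (f (x + y)) = Re (f x) + Re (f y).
Proof. by rewrite functD raddfD. Qed.
Lemma Re_functZ (r : R) x : Re (f (r%:C%C *: x)) = r * Re (f x).
Proof. by rewrite functZ; case: (f x) => p q /=; rewrite mul0r subr0. Qed.
Lemma Re_functN x : Re (f (- x)) = - Re (f x).
Proof. by rewrite -scaleN1r functZ mulN1r raddfN. Qed.

Lemma funct_sa x : star x = x -> f x = (Re (f x))%:C%C.
Proof.
move=> sx; have := funct_star x; rewrite sx; case: (f x) => p q [] /eqP.
by rewrite -addr_eq0 -mulr2n mulrn_eq0 /= => /eqP ->.
Qed.

Lemma funct_bounded : exists2 M : R, 0 <= M & forall x, normc (f x) <= M * norm x.
Proof.
have [M fM] := Hf.1.2; exists `|M| => // x.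
by rewrite (le_trans (fM x)) // ler_wpM2r ?(cs_norm_ge0 HA) // ler_norm.
Qed.

End Functional.

(** * The norm of the sandwiched functional and decompositions of [f] *)

Section Decomposition.
Variables (a b : A) (f : A -> R[i]).
Hypothesis Hf : hermitian_functional star norm f.
Hypotheses (pb : upos (iota b)) (bE : b ** b = a).

Let sb : star b = b.
Proof. exact: sa_of_upos. Qed.

Let sandw x := f (b ** (x ** b)).

Lemma norm_sandwich_arg x : norm (b ** (x ** b)) <= norm b ^+ 2 * norm x.
Proof.
rewrite (le_trans (cs_normM HA _ _)) // expr2 -mulrA ler_wpM2l ?(cs_norm_ge0 HA) //.
by rewrite mulrC (cs_normM HA).
Qed.

Lemma sandwich_ub :
  has_ubound [set r : R | exists x, norm x <= 1 /\ r = normc (sandw x)].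
Proof.
have [M M0 fM] := funct_bounded Hf; exists (M * norm b ^+ 2) => _ [x [x1 ->]].
apply: (le_trans (fM _)); rewrite ler_wpM2l // (le_trans (norm_sandwich_arg x)) //.
by rewrite ler_piMr // sqr_ge0.
Qed.

Lemma sandwich_le_dual_norm x : norm x <= 1 -> normc (sandw x) <= dual_norm norm sandw.
Proof. by move=> x1; apply: ub_le_sup sandwich_ub _ _; exists x. Qed.

(** In the unitization the element is [b (1 - y) b], with [1 - y] positive. *)
Lemma pos_sandwich y : star y = y -> norm y <= 1 ->
  Cstar_pos mul star (a - b ** (y ** b)).
Proof.
move=> sy y1; apply/(Cstar_posP HA).
have -> : iota (a - b ** (y ** b)) = ustar (iota b) * (rs 1 - iota y) * iota b.
  rewrite pb.1 -bE inj_unitB !inj_unitM rscal1; ncring.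
apply: (pos_conj HU); apply: (pos_rscalB HU); first by rewrite -inj_unit_star sy.
by rewrite unorm_inj.
Qed.

(** For [z = f (b x b)], a unimodular [w] rotates [z] onto its modulus. As [f] is hermitian,
    replacing [w x] by its self-adjoint part [y] keeps the real part, so [f (b y b)] has real part
    [normc z]. Then [b y b <= a] is used under [f1] and [- b y b <= a] under [f2]. *)
Lemma dual_norm_sandwich_le f1 f2 (r : R) :
  pos_functional mul star norm f1 -> pos_functional mul star norm f2 ->
  (forall x, f x = f1 x - f2 x) -> r%:C%C = f1 a + f2 a ->
  dual_norm norm sandw <= r.
Proof.
move=> [[[f1D f1Z] _] f1p] [[[f2D f2Z] _] f2p] fE rE.
have key g (gD : forall x y, g (x + y) = g x + g y)
    (gZ : forall (c : R[i]) x, g (c *: x) = c * g x)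
    (gp : forall x, Cstar_pos mul star x -> 0 <= g x) y :
    star y = y -> norm y <= 1 -> Re (g (b ** (y ** b))) <= Re (g a).
  move=> sy y1; have := gp _ (pos_sandwich sy y1).
  rewrite gD -scaleN1r gZ mulN1r lecE => /andP[_].
  by rewrite raddfB subr_ge0.
have pa : Cstar_pos mul star a.
  by apply/(Cstar_posP HA); rewrite -bE inj_unitM; apply: (pos_sqr HU); exact: pb.1.
have rR : r = Re (f1 a) + Re (f2 a) by rewrite -raddfD -rE.
have r0 : 0 <= r.
  have := f1p _ pa; have := f2p _ pa; rewrite !lecE /= => /andP[_ h2] /andP[_ h1].
  by rewrite rR addr_ge0.
apply: ge_sup; first by exists (normc (sandw 0)), 0; rewrite (cs_norm0 HA).
move=> _ [x [x1 ->]]; set z := sandw x.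
have [->|z0] := eqVneq z 0; first by rewrite ComplexField.Normc.normc0.
have nz : normc z != 0.
  by apply: contra z0 => /eqP /ComplexField.Normc.eq0_normc ->.
pose w := conjc z * (normc z)^-1%:C%C; pose y := herm (w *: x).
have w1 : normc w = 1.
  rewrite ComplexField.Normc.normcM normc_conj normc_real ger0_norm ?mulfV //.
  by rewrite invr_ge0 normc_ge0.
have y1 : norm y <= 1.
  by rewrite (le_trans (norm_herm _)) // (cs_normZ HA) w1 mul1r.
have sy : star y = y by exact: star_herm.
have wz : w * z = (normc z)%:C%C.
  rewrite /w mulrAC (mulrC (conjc z)).
  have -> : z * conjc z = (normc z ^+ 2)%:C%C.
    case: (z) => p q; rewrite /= sqr_sqrtr ?addr_ge0 ?sqr_ge0 //.
    apply/eqP; rewrite eq_complex /=; apply/andP; split; apply/eqP; ring.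
  by rewrite -rmorphM expr2 mulfK.
have fy : Re (f (b ** (y ** b))) = normc z.
  have -> : b ** (y ** b) = herm (b ** (w *: x ** b)).
    rewrite /y /herm (cs_mulZl HA) (cs_mulZr HA) (cs_mulDl HA) (cs_mulDr HA).
    by rewrite !(cs_starM HA) sb !(cs_mulA HA).
  rewrite /herm (Re_functZ Hf) (Re_functD Hf) (funct_star Hf).
  rewrite (cs_mulZl HA) (cs_mulZr HA) (functZ Hf) -/(sandw x) -/z wz /=.
  by field.
have yN : norm (- y) <= 1 by rewrite (cs_normN HA).
have syN : star (- y) = - y by rewrite (cs_starN HA) sy.
have := key f1 f1D f1Z f1p _ sy y1; have := key f2 f2D f2Z f2p _ syN yN.
have -> : b ** (- y ** b) = - (b ** (y ** b)).
  by rewrite -[- y]scaleN1r (cs_mulZl HA) (cs_mulZr HA) scaleN1r.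
rewrite -[- (b ** _)]scaleN1r f2Z mulN1r raddfN /= -fy fE raddfB rR /=; lra.
Qed.

Variable N : R.
Hypothesis NE : dual_norm norm sandw = N.

(* [x = (b + e) y (b + e)] with [y] a self-adjoint contraction of [A]. *)
Lemma Re_funct_le_dual_norm M (e : R) x : 0 < e -> 0 <= M ->
    (forall x, normc (f x) <= M * norm x) -> star x = x ->
    upos ((iota b + rs e) * (iota b + rs e) - iota x) ->
    upos ((iota b + rs e) * (iota b + rs e) + iota x) ->
  Re (f x) <= N + M * (2 * e * norm b + e ^+ 2).
Proof.
move=> e0 M0 fM sx; set d := iota b + rs e => pm pp.
have [v [dv vd]] : invertible d by exact: pos_invertible HU _ _ _ _.
have sd : ustar d = d by rewrite /d (cs_starD HU) pb.1 (star_rscal HU).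
have sv : ustar v = v by exact: (invertible_star_id HU sd dv vd).
(* [A] is an ideal of the unitization, so this product has scalar part 0 and [y] represents it
   faithfully. *)
pose y := (v * iota x * v).1.
have iy : iota y = v * iota x * v.
  by apply: inj_unit_fst; rewrite /= mulr0 mul0r.
have sy : star y = y.
  apply: (@inj_unit_inj _ _ _ _ _ HA); rewrite inj_unit_star iy !(cs_starM HU) sv.
  by rewrite -inj_unit_star sx mulrA.
have vddv : v * (d * d) * v = 1 by rewrite mulrA vd mul1r.
have y1 : norm y <= 1.
  rewrite -(unorm_inj HA); apply: (norm_le_pos HU) => //.
  - by rewrite -inj_unit_star sy.
  - have -> : rs 1 - iota y = ustar v * (d * d - iota x) * v.
      by rewrite sv mulrBr mulrBl vddv -iy rscal1.
    exact: (pos_conj HU).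
  - have -> : rs 1 + iota y = ustar v * (d * d + iota x) * v.
      by rewrite sv mulrDr mulrDl vddv -iy rscal1.
    exact: (pos_conj HU).
have xE : x = b ** (y ** b) + (e%:C%C *: (y ** b + b ** y) + (e ^+ 2)%:C%C *: y).
  apply: (@inj_unit_inj _ _ _ _ _ HA).
  rewrite !inj_unitD !inj_unit_rscal inj_unitD !inj_unitM.
  have -> : iota x = d * iota y * d.
    by rewrite iy !mulrA dv mul1r -mulrA vd mulr1.
  have -> : d * iota y * d = iota b * (iota y * iota b) +
     (rs e * (iota y * iota b) + iota b * (iota y * rs e) + rs e * (iota y * rs e)).
    by rewrite /d; ncring.
  rewrite (rscalC e (iota y)).
  have -> : iota b * (rs e * iota y) = rs e * (iota b * iota y).
    by rewrite mulrA (rscalC e (iota b)) mulrA.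
  by rewrite rscal_sqr mulrDr !mulrA.
rewrite xE (Re_functD Hf); apply: lerD.
  by rewrite -NE (le_trans (ler_Re_normc _)) // sandwich_le_dual_norm.
rewrite (Re_functD Hf) !(Re_functZ Hf).
have nb := cs_norm_ge0 HA b; have ny := cs_norm_ge0 HA y.
have h1 : Re (f (y ** b + b ** y)) <= M * (2 * norm b).
  apply: (le_trans (ler_Re_normc _)); apply: (le_trans (fM _)).
  rewrite ler_wpM2l //; apply: (le_trans (cs_normD HA _ _)).
  by have := cs_normM HA y b; have := cs_normM HA b y; nra.
have h2 : Re (f y) <= M.
  by apply: (le_trans (ler_Re_normc _)); apply: (le_trans (fM _)); rewrite ler_piMr.
rewrite mulrDr; apply: lerD.
  rewrite (_ : M * _ = e * (M * (2 * norm b))); last by ring.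
  by rewrite ler_wpM2l // ltW.
by rewrite [leRHS]mulrC ler_wpM2l // sqr_ge0.
Qed.

(** * A decomposition from a bound [c] of [f] on the order interval from 0 to [D] *)

Section Domination.
Variables (e c : R).
Hypothesis e0 : 0 < e.
Let D : U := (iota b + rs e) * (iota b + rs e).
Hypothesis fc : forall v, upos (iota v) -> upos (D - iota v) -> Re (f v) <= c.

Let DE : D = iota a + rs (2 * e) * iota b + rs (e ^+ 2).
Proof.
rewrite /D -bE inj_unitM rscal_sqr (_ : 2 * e = e + e); last by ring.
have -> : (iota b + rs e) * (iota b + rs e) = iota b * iota b + rs e * iota b
  + iota b * rs e + rs e * rs e by ncring.
by rewrite (rscalC e (iota b)) rscalD mulrDl !addrA.
Qed.

Let pa : upos (iota a).
Proof. by rewrite -bE inj_unitM; apply: (pos_sqr HU); exact: pb.1. Qed.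

Let pDa : upos (D - iota a).
Proof.
have -> : D - iota a = rs (2 * e) * iota b + rs (e ^+ 2) by rewrite DE; ncring.
apply: (pos_add HU).
  by apply: (pos_rscalM HU) => //; rewrite mulr_ge0 // ltW.
by apply: (pos_rscal HU); exact: sqr_ge0.
Qed.

Let pDe : upos (D - rs (e ^+ 2)).
Proof.
rewrite DE addrK; apply: (pos_add HU) => //.
by apply: (pos_rscalM HU) => //; rewrite mulr_ge0 // ltW.
Qed.

Let pD : upos D.
Proof. by rewrite -[D](subrK (iota a)); exact: (pos_add HU). Qed.

Let c0 : 0 <= c.
Proof.
have := fc (v := 0); rewrite inj_unit0 subr0 (funct0 Hf); apply => //.
exact: (pos_0 HU).
Qed.

Let fc_scaled t v : 0 <= t -> upos (iota v) -> upos (rs t * D - iota v) ->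
  Re (f v) <= t * c.
Proof.
rewrite le_eqVlt => /orP[/eqP <-|t0] pv ptv.
  rewrite rscal0 !mul0r sub0r in ptv *.
  have := pos_antisym HU pv ptv; rewrite -inj_unit0 => /inj_unit_inj ->.
  by rewrite (funct0 Hf).
have ti : 0 <= t^-1 by rewrite invr_ge0 ltW.
have : Re (f (t^-1%:C%C *: v)) <= c.
  apply: fc; first by rewrite inj_unit_rscal; exact: (pos_rscalM HU).
  have -> : D - iota (t^-1%:C%C *: v) = rs t^-1 * (rs t * D - iota v).
    by rewrite inj_unit_rscal mulrBr mulrA -rscalM mulVf ?gt_eqF // rscal1 mul1r.
  exact: (pos_rscalM HU).
by rewrite (Re_functZ Hf) mulrC ler_pdivrMr // mulrC.
Qed.

Let K y := norm (herm y) / e ^+ 2.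

Let K_ge0 y : 0 <= K y.
Proof. by rewrite divr_ge0 ?(cs_norm_ge0 HA) ?sqr_ge0. Qed.

(** [D] is an order unit because [D >= e^2]: scaled by [norm x / e^2] it is above [norm x], hence
    above [x]. *)
Let KD x : star x = x -> upos (rs (norm x / e ^+ 2) * D - iota x).
Proof.
move=> sx; set t := norm x / _; have tE : t = norm x / e ^+ 2 by [].
have -> : rs t * D - iota x = rs t * (D - rs (e ^+ 2)) + (rs (norm x) - iota x).
  rewrite mulrBr -rscalM tE divfK; last by rewrite expf_neq0 // gt_eqF.
  by rewrite subrKA.
apply: (pos_add HU).
  by apply: (pos_rscalM HU) => //; rewrite tE divr_ge0 ?(cs_norm_ge0 HA) ?sqr_ge0.
by apply: (pos_rscalB HU); [exact: inj_unit_sa|rewrite unorm_inj].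
Qed.

Let T y := [set s : R | exists t v, [/\ 0 <= t, upos (iota v),
  upos (rs t * D - iota v - iota (herm y)) & s = t * c - Re (f v)]].

Let p y := inf (T y).

Let T_K y : T y (K y * c).
Proof.
exists (K y), 0; split => //.
- exact: (pos_0 HU).
- by rewrite inj_unit0 subr0; apply: KD; exact: star_herm.
- by rewrite (funct0 Hf) subr0.
Qed.

(** Adding [y + v <= t D] and [- y <= K D] gives [v <= (t + K) D], so [f v <= (t + K) c]. Hence the
    infimum [p] is finite. *)
Let T_lb y : lbound (T y) (- (K y * c)).
Proof.
move=> _ [t [v [t0 pv ptv ->]]].
have h : upos (rs (K y) * D + iota (herm y)).
  rewrite -[iota (herm y)]opprK -inj_unitN /K -(cs_normN HA); apply: KD.
  by rewrite (cs_starN HA) star_herm.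
have : Re (f v) <= (t + K y) * c.
  apply: fc_scaled => //; first by rewrite addr_ge0.
  have -> : rs (t + K y) * D - iota v = (rs t * D - iota v - iota (herm y))
     + (rs (K y) * D + iota (herm y)) by rewrite rscalD; ncring.
  exact: (pos_add HU).
by lra.
Qed.

Let p_le y s : T y s -> p y <= s.
Proof. by apply: ge_inf; exists (- (K y * c)); exact: T_lb. Qed.

Let T_neq0 y : T y !=set0. Proof. by exists (K y * c); exact: T_K. Qed.

Let p_sublinear : sublinear p.
Proof.
split=> [x y|r x r0].
  rewrite -lerBlDr; apply: lb_le_inf => // _ [t [v [t0 pv ptv ->]]].
  rewrite lerBlDr -lerBlDl; apply: lb_le_inf => // _ [t' [v' [t'0 pv' ptv' ->]]].
  rewrite lerBlDl; apply: p_le; exists (t + t'), (v + v'); split.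
  - exact: addr_ge0.
  - by rewrite inj_unitD; exact: (pos_add HU).
  - have -> : rs (t + t') * D - iota (v + v') - iota (herm (x + y)) =
      (rs t * D - iota v - iota (herm x)) + (rs t' * D - iota v' - iota (herm y)).
      by rewrite hermD !inj_unitD rscalD; ncring.
    exact: (pos_add HU).
  - by rewrite (Re_functD Hf); ring.
rewrite mulrC -ler_pdivrMr //; apply: lb_le_inf => // _ [t [v [t0 pv ptv ->]]].
have r0' := ltW r0.
rewrite ler_pdivrMr //; apply: p_le; exists (r * t), (r%:C%C *: v); split.
- exact: mulr_ge0.
- by rewrite inj_unit_rscal; exact: (pos_rscalM HU).
- have -> : rs (r * t) * D - iota (r%:C%C *: v) - iota (herm (r%:C%C *: x)) =
    rs r * (rs t * D - iota v - iota (herm x)).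
    by rewrite herm_realZ !inj_unit_rscal rscalM; ncring.
  exact: (pos_rscalM HU).
- by rewrite (Re_functZ Hf); ring.
Qed.

(** All properties of [G] come from explicit pairs [(t, v)] in the definition of [p]: [(0, 0)] shows
    that [G] kills skew elements and is nonnegative on positive ones, [(0, v)] tested at [- v] gives
    [G v >= f v], and [(1, 0)] at [a] gives [G a <= c]. *)
Lemma dominated_decomposition : exists f1 f2 (r : R),
  [/\ pos_functional mul star norm f1, pos_functional mul star norm f2,
    forall x, f x = f1 x - f2 x, r%:C%C = f1 a + f2 a & r <= 2 * c - Re (f a)].
Proof.
have [G [GD GZ Gp]] := hahn_banach p_sublinear.
have GN x : G (- x) = - G x.
  by have := GZ (-1) x; rewrite rmorphN scaleNr scale1r mulN1r.
have Gs x : star x = - x -> G x = 0.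
  have h z : star z = - z -> G z <= 0.
    move=> sz; apply: (le_trans (Gp z)); apply: p_le; exists 0, 0; split => //.
    - exact: (pos_0 HU).
    - by rewrite herm_skew // inj_unit0 rscal0 mul0r !subr0; exact: (pos_0 HU).
    - by rewrite (funct0 Hf) mul0r subr0.
  move=> sx; apply/eqP; rewrite eq_le h //= -oppr_le0 -GN h //.
  by rewrite (cs_starN HA) sx.
have G_ge v : upos (iota v) -> 0 <= G v /\ Re (f v) <= G v.
  move=> pv; have sv := sa_of_upos pv.
  have hv : herm (- v) = - v by rewrite herm_id // (cs_starN HA) sv.
  split; rewrite -lerN2 -GN; apply: (le_trans (Gp _)); apply: p_le.
    exists 0, 0; split => //; first exact: (pos_0 HU).
      by rewrite rscal0 mul0r inj_unit0 hv inj_unitN opprK !sub0r oppr0 add0r.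
    by rewrite (funct0 Hf) mul0r subr0 oppr0.
  exists 0, v; split => //; last by rewrite mul0r sub0r.
  rewrite rscal0 mul0r hv inj_unitN opprK sub0r addrC subrr.
  exact: (pos_0 HU).
have Ga : G a <= c.
  apply: (le_trans (Gp _)); apply: p_le; exists 1, 0; split => //.
  - exact: (pos_0 HU).
  - have sa := sa_of_upos pa.
    by rewrite herm_id // inj_unit0 subr0 rscal1 mul1r.
  - by rewrite (funct0 Hf) mul1r subr0.
pose B := c / e ^+ 2; have B0 : 0 <= B by rewrite divr_ge0 ?sqr_ge0.
have Gle x : G x <= B * norm x.
  apply: (le_trans (Gp _)); apply: (le_trans (p_le (T_K x))).
  rewrite /K mulrC mulrCA mulrC -/B ler_wpM2l ?norm_herm //.
have Gb x : `|G x| <= B * norm x.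
  by rewrite ler_norml Gle andbT lerNl -GN -(cs_normN HA) Gle.
(* The complex-linear functional with real part [G]. It is real on self-adjoint [v], since [i v] is
   skew and [G] vanishes there. *)
pose f1 x : R[i] := Complex (G x) (- G ('i%C *: x)).
have f1D x y : f1 (x + y) = f1 x + f1 y.
  by rewrite /f1 scalerDr !GD opprD.
have f1Z z x : f1 (z *: x) = z * f1 x.
  have GC w y : G (w *: y) = Re w * G y + complex.Im w * G ('i%C *: y).
    by rewrite {1}(complexE w) scalerDl GD GZ (mulrC 'i%C) -scalerA GZ.
  apply/eqP; rewrite /f1 scalerA eq_complex (GC z) (GC ('i%C * z)).
  by case: z => u v /=; apply/andP; split; apply/eqP; ring.
have f1c : cont_functional norm f1.
  split; first by split.
  exists (B + B) => x; apply: (le_trans (normc_le _)); rewrite /= normrN mulrDl.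
  apply: lerD => //; apply: (le_trans (Gb _)).
  by rewrite (cs_normZ HA) normc_i mul1r.
have f1v v : star v = v -> f1 v = (G v)%:C%C.
  move=> sv; rewrite /f1 (Gs ('i%C *: v)) ?oppr0 // (cs_starZ HA) sv -scaleNr; congr (_ *: _).
  by apply/eqP; rewrite eq_complex /= oppr0 !eqxx.
have [M M0 fM] := funct_bounded Hf.
exists f1, (fun x => f1 x - f x), (2 * G a - Re (f a)); split.
- split => // v /(Cstar_posP HA) pv; rewrite f1v ?ler0c; last exact: sa_of_upos.
  by have [] := G_ge v pv.
- split; first split; first split.
  + by move=> x y; rewrite f1D (functD Hf) opprD addrACA.
  + by move=> z x; rewrite f1Z (functZ Hf) mulrBr.
  + have [M1 f1M] := f1c.2; exists (M1 + M) => x.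
    apply: (le_trans (normc_triangle _ _)); rewrite normc_N mulrDl.
    exact: lerD.
  move=> v /(Cstar_posP HA) pv; rewrite f1v; last exact: sa_of_upos.
  rewrite (funct_sa Hf (sa_of_upos pv)) -rmorphB ler0c subr_ge0.
  by have [] := G_ge v pv.
- by move=> x; rewrite subKr.
- rewrite f1v; last exact: sa_of_upos.
  by rewrite [in RHS](funct_sa Hf (sa_of_upos pa)) -rmorphB -rmorphD /=; congr (_%:C)%C; ring.
- by move: Ga; lra.
Qed.

End Domination.

(** Let [d = b + e] and [0 <= v <= d^2]. Then [2 v - a] lies between [- (b + 2 e)^2] and
    [(b + 2 e)^2]: the differences are [2 (d^2 - v) + 2 e^2] and [2 v + 4 e b + 4 e^2]. So
    [2 f v - f a <= N + eta], which dictates the value of [c]. *)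
Lemma near_optimal_decomposition (eps : R) : 0 < eps -> exists f1 f2 (r : R),
  [/\ pos_functional mul star norm f1, pos_functional mul star norm f2,
    forall x, f x = f1 x - f2 x, r%:C%C = f1 a + f2 a & r <= N + eps].
Proof.
move=> eps0; have [M M0 fM] := funct_bounded Hf; have nb := cs_norm_ge0 HA b.
(* For [e <= 1] the error [eta] is at most [L * e]; the denominator [L + 1] avoids dividing by 0. *)
pose L := M * (4 * norm b + 4); have L0 : 0 <= L by rewrite mulr_ge0 //; lra.
pose e := Num.min 1 (eps / (L + 1)).
have L1 : 0 < L + 1 by lra.
have e0 : 0 < e by rewrite lt_min ltr01 divr_gt0.
have e1 : e <= 1 by rewrite ge_min lexx.
have eL : L * e <= eps.
  have : e <= eps / (L + 1) by rewrite ge_min lexx orbT.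
  by rewrite ler_pdivlMr // => h; nra.
pose eta := M * (2 * (2 * e) * norm b + (2 * e) ^+ 2).
have etaE : eta <= eps.
  apply: le_trans eL; rewrite /eta /L -[leRHS]mulrA ler_wpM2l //.
  by rewrite expr2; nra.
have [|f1 [f2 [r [pf1 pf2 fE rE rc]]]] :=
    @dominated_decomposition e ((N + eta + Re (f a)) / 2) e0.
  move=> v pv pDv.
  have sv := sa_of_upos pv.
  have sa : star a = a by rewrite -bE (cs_starM HA) sb.
  have e20 : 0 < 2 * e by rewrite mulr_gt0.
  have rs2 : rs (2 * e) = rs e + rs e by rewrite -rscalD; congr (rs _); ring.
  have comm := rscalC e (iota b).
  have iE : iota (v + v - a) = iota v + iota v - iota b * iota b.
    by rewrite inj_unitB inj_unitD -bE inj_unitM.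
  have pee : upos (rs e * rs e) by rewrite -rscalM; apply: (pos_rscal HU); rewrite mulr_ge0 // ltW.
  have := @Re_funct_le_dual_norm M (2 * e) (v + v - a) e20 M0 fM.
  rewrite !(Re_functD Hf) (Re_functN Hf) -/eta => h.
  suff : Re (f v) + Re (f v) - Re (f a) <= N + eta by lra.
  apply: h.
  - by rewrite (cs_starB HA) (cs_starD HA) sv sa.
  - rewrite iE rs2; set d := iota b + rs e in pDv *.
    have -> : (iota b + (rs e + rs e)) * (iota b + (rs e + rs e)) -
        (iota v + iota v - iota b * iota b) =
        (d * d - iota v) + (d * d - iota v) + (rs e * rs e + rs e * rs e) by rewrite /d; ncring.
    by do 2 apply: (pos_add HU) => //; exact: (pos_add HU).
  - rewrite iE rs2.
    have -> : (iota b + (rs e + rs e)) * (iota b + (rs e + rs e)) +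
        (iota v + iota v - iota b * iota b) =
        (iota v + iota v) + (rs (4 * e) * iota b + rs (4 * (e * e))) +
        (iota b * rs e - rs e * iota b + (iota b * rs e - rs e * iota b)).
      rewrite (_ : 4 * e = e + e + e + e); last by ring.
      rewrite (_ : 4 * (e * e) = e * e + e * e + e * e + e * e); last by ring.
      by rewrite !rscalD !rscalM; ncring.
    rewrite comm subrr !addr0; apply: (pos_add HU); first exact: (pos_add HU).
    apply: (pos_add HU).
      by apply: (pos_rscalM HU) => //; rewrite mulr_ge0 // ltW.
    by apply: (pos_rscal HU); rewrite !mulr_ge0 // ltW.
by exists f1, f2, r; split => //; lra.
Qed.

End Decomposition.
End HermitianFunctional.

Theorem theorem14 (R : realType) (A : lmodType R[i])
    (mul : A -> A -> A) (star : A -> A) (norm : A -> R)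
    (HA : is_Cstar_algebra mul star norm)
    (a : A) (Ha : Cstar_pos mul star a)
    (f : A -> R[i]) (Hf : hermitian_functional star norm f) :
  dual_norm norm (sandwich mul star a f) =
  inf [set r : R | exists f1 f2 : A -> R[i],
         pos_functional mul star norm f1 /\ pos_functional mul star norm f2 /\
         (forall x, f x = f1 x - f2 x) /\ (r%:C)%C = f1 a + f2 a].
Proof.
have [/(Cstar_posP HA) pb bE] := Cstar_sqrtP HA Ha.
have near eps := near_optimal_decomposition Hf pb bE (erefl _) (eps := eps).
apply/eqP; rewrite eq_le; apply/andP; split.
(* The infimum of an empty set is a default value, so a decomposition is exhibited first, with error
   1. *)
- apply: lb_le_inf.
    have [f1 [f2 [r [pf1 pf2 fE rE _]]]] := near _ ltr01.
    by exists r, f1, f2.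
  move=> r [f1 [f2 [pf1 [pf2 [fE rE]]]]].
  exact: (dual_norm_sandwich_le Hf pb bE pf1 pf2 fE rE).
- apply/ler_addgt0Pr => eps /near[f1 [f2 [r [pf1 pf2 fE rE rN]]]].
  apply: le_trans rN; apply: ge_inf; last by exists f1, f2.
  (* The first inequality also supplies the lower bound that makes this infimum genuine. *)
  exists (dual_norm norm (sandwich mul star a f)) => s [g1 [g2 [pg1 [pg2 [gE sE]]]]].
  exact: (dual_norm_sandwich_le Hf pb bE pg1 pg2 gE sE).
Qed.
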